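(* Let $\xi_m>0$ be fixed. For $\mu\in(0,\xi_m]$, $\lambda>0$ and $T>0$, consider the equation in the unknown $\Delta\ge 0$ $$\frac{\xi_m}{\lambda}\Delta=2T\ln\frac{\cosh\!\big(\sqrt{\xi_m^2+\Delta^2}/2T\big)}{\cosh\!\big(\sqrt{\mu^2+\Delta^2}/2T\big)}\,\Delta+\mu\int_0^{\mu}\tanh\!\Big(\frac{\sqrt{\xi^2+\Delta^2}}{2T}\Big)\frac{\Delta}{\sqrt{\xi^2+\Delta^2}}\,d\xi. \qquad (\mathrm{R})$$ Then: (i) For every $\mu\in(0,\xi_m]$ and $\lambda>0$ there is a critical temperature $T_c=T_c(\mu,\lambda)>0$ such that for $0<T<T_c$ equation (R) has a unique positive solution $\Delta=\Delta(\mu,T,\lambda)$, while for $T\ge T_c$ the only nonnegative solution of (R) is $\Delta=0$. Moreover $\Delta(\mu,T,\lambda)$ (on $\{T<T_c\}$) and $T_c(\mu,\lambda)$ depend smoothly on their arguments. (ii) For $0<T<T_c$: $\partial\Delta/\partial\mu>0$, $\partial\Delta/\partial T<0$, $\partial\Delta/\partial\lambda>0$. (iii) $\Delta(\mu,T,\lambda)\to 0$ as $T\to T_c^-$. (iv) $T_c$ is the unique positive solution $T_c$ of $$\frac{\xi_m}{\lambda}=2T_c\ln\frac{\cosh(\xi_m/2T_c)}{\cosh(\mu/2T_c)}+\mu\int_0^{\mu}\frac{1}{\xi}\tanh\Big(\frac{\xi}{2T_c}\Big)\,d\xi .$$ (v) $\partial T_c/\partial\mu>0$ and $\partial T_c/\partial\lambda>0$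 for $\mu\in(0,\xi_m]$, $\lambda>0$. (vi) The zero-temperature equation $$\frac{\xi_m}{\lambda}=\sqrt{\xi_m^2+\Delta_0^2}-\sqrt{\mu^2+\Delta_0^2}+\mu\ln\frac{\mu+\sqrt{\mu^2+\Delta_0^2}}{\Delta_0}$$ has a unique positive solution $\Delta_0=\Delta_0(\mu,\lambda)$, which equals $\lim_{T\to0}\Delta(\mu,T,\lambda)$ and satisfies $\Delta_0>\Delta(\mu,T,\lambda)\ge0$ for $T>0$. $\Delta_0$ depends smoothly on $\mu\in(0,\xi_m]$, $\lambda>0$ with $\partial\Delta_0/\partial\mu>0$, $\partial\Delta_0/\partial\lambda>0$, and $$\frac{\xi_m}{2}\Big(\lambda-\frac1\lambda\Big)<\Delta_0(\mu,\lambda)<\frac{\xi_m}{\sinh(1/\lambda)},\qquad \mu\in(0,\xi_m),\ \lambda>0,$$ where the right-hand side is $\Delta_0(\xi_m,\lambda)$ and the left-hand side is the value at $\mu=0$ (the solution of the zero-temperature equation with $\mu=0$, which is positive only when $\lambda>1$). (vii) When $\mu=0$ and $T>0$, equation (R) can have a positive solution only if $\lambda>1$.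
   Context: Physical parameters: absolute temperature $T$, gap $\Delta\ge0$, Fermi truncation energy $\xi_m>0$, doping level $\mu$ subject to the low-doping condition $|\mu|\le\xi_m$ (the equations depend on $\mu$ only through $|\mu|$, so $\mu\ge0$ is assumed), pairing coupling constant $\lambda>0$. At $\mu=0$ the integral term in (R) vanishes. The zero-temperature equation is the $T\to0$ limit of (R) divided by $\Delta$. *)

(* Defs.v *)
From Stdlib Require Import Reals Lra ClassicalEpsilon.
Open Scope R_scope.

(* Total Riemann integral: the Riemann integral of f over [a,b] when f is
   Riemann integrable there, and 0 otherwise.  (RiemannInt does not depend
   on the integrability proof, RiemannInt_P5.) *)
Definition RInt (f : R -> R) (a b : R) : R :=
  match excluded_middle_informative (inhabited (Riemann_integrable f a b)) with
  | left H => RiemannInt (epsilon H (fun _ => True))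
  | right _ => 0
  end.

Definition upd (x : nat -> R) (i : nat) (t : R) : nat -> R :=
  fun j => if Nat.eqb j i then t else x j.

Definition near (n : nat) (x y : nat -> R) (d : R) : Prop :=
  forall i, (i < n)%nat -> Rabs (y i - x i) < d.

Definition cont_on (n : nat) (U : (nat -> R) -> Prop) (f : (nat -> R) -> R) : Prop :=
  forall x, U x -> forall eps, 0 < eps -> exists d, 0 < d /\
    forall y, U y -> near n x y d -> Rabs (f y - f x) < eps.

Definition has_pderiv_within (U : (nat -> R) -> Prop) (f : (nat -> R) -> R)
  (i : nat) (x : nat -> R) (l : R) : Prop :=
  forall eps, 0 < eps -> exists d, 0 < d /\
    forall h, h <> 0 -> Rabs h < d -> U (upd x i (x i + h)) ->
      Rabs ((f (upd x i (x i + h)) - f x) / h - l) < eps.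

Fixpoint Ck (n k : nat) (U : (nat -> R) -> Prop) (f : (nat -> R) -> R) : Prop :=
  cont_on n U f /\
  match k with
  | O => True
  | S k' => forall i, (i < n)%nat -> exists g : (nat -> R) -> R,
      (forall x, U x -> has_pderiv_within U f i x (g x)) /\ Ck n k' U g
  end.

Definition Smooth (n : nat) (U : (nat -> R) -> Prop) (f : (nat -> R) -> R) : Prop :=
  forall k, Ck n k U f.

Definition pos_pderiv (U : (nat -> R) -> Prop) (f : (nat -> R) -> R) (i : nat) : Prop :=
  forall x, U x -> exists l, has_pderiv_within U f i x l /\ 0 < l.

Definition neg_pderiv (U : (nat -> R) -> Prop) (f : (nat -> R) -> R) (i : nat) : Prop :=
  forall x, U x -> exists l, has_pderiv_within U f i x l /\ l < 0.

Definition gapR (xm mu T lam D : R) : Prop :=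
  xm / lam * D =
    2 * T * ln (cosh (sqrt (xm ^ 2 + D ^ 2) / (2 * T))
                / cosh (sqrt (mu ^ 2 + D ^ 2) / (2 * T))) * D
    + mu * RInt (fun xi => tanh (sqrt (xi ^ 2 + D ^ 2) / (2 * T))
                           * D / sqrt (xi ^ 2 + D ^ 2)) 0 mu.

Definition TcEq (xm mu lam Tc : R) : Prop :=
  xm / lam =
    2 * Tc * ln (cosh (xm / (2 * Tc)) / cosh (mu / (2 * Tc)))
    + mu * RInt (fun xi => / xi * tanh (xi / (2 * Tc))) 0 mu.

Definition gap0 (xm mu lam D0 : R) : Prop :=
  xm / lam =
    sqrt (xm ^ 2 + D0 ^ 2) - sqrt (mu ^ 2 + D0 ^ 2)
    + mu * ln ((mu + sqrt (mu ^ 2 + D0 ^ 2)) / D0).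

(* Main.v *)
(* For D > 0 the gap equation divided by D reads [gapH mu T D = xm / lam], where
   gapH is the integral over 0 < xi < xm of
   max (xi, mu) tanh (r / 2T) / r with r = sqrt (xi^2 + D^2).  It increases in mu
   and decreases strictly in T and in D; its limits as D -> 0 and as T -> 0 are
   gapG and gapZ, whose level sets define Tc and the zero-temperature gap.
   Monotonicity and the intermediate value theorem give existence and
   uniqueness; the implicit function theorem gives the signs of the partial
   derivatives, -F_i / F_y.  Smoothness is a bootstrap: these quotients are
   smooth expressions in the arguments and in the solution itself, so a solution
   that is C^k is C^(k+1).  The only non-elementary ingredient, the integral in
   (R), becomes after scaling Psi (a, q) = int_0^a gam (t^2 + q) dt with
   gam (u) = tanh (sqrt u) / sqrt u, and such integrals are closed under
   differentiation because d/dq only replaces gam by its derivative. *)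
Require Import Defs.
From Stdlib Require Import Reals Lra Lia FunctionalExtensionality ClassicalEpsilon.
From Coquelicot Require Import Coquelicot.
Open Scope R_scope.

(** * Functions of class C^k on arbitrary domains *)

(** The domains contain the boundary value [mu = xm], where the solutions can only be differentiated
    in [mu] from one side. Smoothness is therefore relative to the domain, and the calculus of C^k
    functions, chain rule included, is developed for arbitrary sets. The gap functions are given by
    formulas that make sense across [mu = xm], so their own partial derivatives are two-sided; only
    the solutions are differentiated within the domain. In the implicit function theorem, strict
    decrease in the unknown traps the solution, and the mean value theorem in the unknown alone
    produces the quotient.

    At [mu = xm] the range [mu < xi < xm] disappears, so strictness of the monotonicity in [T] and
    in [D] has to come from the integral over [0 < xi < mu]. For [D] it rests on sech^2 z < tanh z /
    z, for [T] on a scaling identity for [Psi].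

    The limits [D -> 0] and [T -> 0] enter through explicit inequalities, with an error linear in
    [D] against [gapG] and linear in [T] against [gapZ]. They place the test points for the
    intermediate value theorem, exclude solutions above [Tc], and yield the limit at zero
    temperature. *)

Lemma upd_same (x : nat -> R) (i : nat) : upd x i (x i) = x.
Proof.
  apply functional_extensionality; intros j; unfold upd.
  destruct (Nat.eqb_spec j i); congruence.
Qed.

Lemma upd_eq (x : nat -> R) (i : nat) (t : R) : upd x i t i = t.
Proof. unfold upd; now rewrite Nat.eqb_refl. Qed.

Lemma upd_neq (x : nat -> R) (i j : nat) (t : R) : j <> i -> upd x i t j = x j.
Proof. intros H; unfold upd; destruct (Nat.eqb_spec j i); congruence. Qed.

Lemma cont_on_ext n U f g :
  (forall x, U x -> f x = g x) -> cont_on n U f -> cont_on n U g.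
Proof.
  intros E H x Ux eps He; destruct (H x Ux eps He) as [d [Hd K]].
  exists d; split; [exact Hd|]; intros y Uy Hy.
  rewrite <- !E by assumption; auto.
Qed.

Lemma has_pderiv_within_ext U f g i x l :
  (forall y, U y -> f y = g y) -> U x ->
  has_pderiv_within U f i x l -> has_pderiv_within U g i x l.
Proof.
  intros E Ux H eps He; destruct (H eps He) as [d [Hd K]].
  exists d; split; [exact Hd|]; intros h h0 hd Uh.
  rewrite <- !E by assumption; auto.
Qed.

Lemma Ck_ext n k U : forall f g,
  (forall x, U x -> f x = g x) -> Ck n k U f -> Ck n k U g.
Proof.
  destruct k as [|k]; intros f g E [H1 H2]; (split; [now apply cont_on_ext with f|]).
  - exact I.
  - intros i Hi; destruct (H2 i Hi) as [d [Hd K]]; exists d; split; [|exact K].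
    intros x Ux; apply has_pderiv_within_ext with f; auto.
Qed.

Lemma Ck_cont n k U f : Ck n k U f -> cont_on n U f.
Proof. destruct k; now intros [H _]. Qed.

Lemma Ck_S n k U : forall f, Ck n (S k) U f -> Ck n k U f.
Proof.
  induction k as [|k IH]; intros f [H1 H2]; split; auto.
  intros i Hi; destruct (H2 i Hi) as [g [Hg K]]; exists g; auto.
Qed.

Lemma cont_on_const n U c : cont_on n U (fun _ => c).
Proof.
  intros x _ eps He; exists 1; split; [lra|]; intros.
  now rewrite Rminus_diag, Rabs_R0.
Qed.

Lemma Ck_const n U k : forall c, Ck n k U (fun _ => c).
Proof.
  induction k as [|k IH]; intros c; split; auto using cont_on_const.
  intros i _; exists (fun _ => 0); split; auto.
  intros x _ eps He; exists 1; split; [lra|]; intros.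
  replace ((c - c) / h - 0) with 0 by (field; auto). now rewrite Rabs_R0.
Qed.

Lemma cont_on_proj n U j : (j < n)%nat -> cont_on n U (fun x => x j).
Proof. intros Hj x _ eps He; exists eps; split; auto. Qed.

Lemma Ck_proj n U k j : (j < n)%nat -> Ck n k U (fun x => x j).
Proof.
  intros Hj; destruct k as [|k]; split; auto using cont_on_proj.
  intros i _; exists (fun _ => if Nat.eqb j i then 1 else 0); split; auto using Ck_const.
  intros x _ eps He; exists 1; split; [lra|]; intros h h0 _ _.
  unfold upd; destruct (Nat.eqb_spec j i) as [->|_].
  - replace ((x i + h - x i) / h - 1) with 0 by (field; auto). now rewrite Rabs_R0.
  - replace ((x j - x j) / h - 0) with 0 by (field; auto). now rewrite Rabs_R0.
Qed.

Lemma cont_on_comp2 n U g f1 f2 :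
  (forall x, U x -> continuity_2d_pt g (f1 x) (f2 x)) ->
  cont_on n U f1 -> cont_on n U f2 -> cont_on n U (fun x => g (f1 x) (f2 x)).
Proof.
  intros Hg H1 H2 x Ux eps He.
  destruct (Hg x Ux (mkposreal eps He)) as [d Hd].
  destruct (H1 x Ux d (cond_pos d)) as [d1 [D1 K1]].
  destruct (H2 x Ux d (cond_pos d)) as [d2 [D2 K2]].
  exists (Rmin d1 d2); split; [now apply Rmin_pos|].
  intros y Uy Hy; apply Hd; [apply K1 | apply K2]; auto; intros i Hi;
    specialize (Hy i Hi); [apply Rlt_le_trans with (2 := Rmin_l d1 d2)
      | apply Rlt_le_trans with (2 := Rmin_r d1 d2)]; auto.
Qed.

(** The increments of [f1] and [f2] are [q1 * h] and [q2 * h] with difference quotients bounded by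
    [M], so they are O(h) and the linear approximation of [g] applies. One half of [eps] pays for
    that approximation, the other for replacing [q1], [q2] by [l1], [l2]. Only increments staying in
    [U] occur, while [g] is differentiable in the full plane. *)
Lemma has_pderiv_within_comp2 U g f1 f2 i x lx ly l1 l2 :
  differentiable_pt_lim g (f1 x) (f2 x) lx ly ->
  has_pderiv_within U f1 i x l1 -> has_pderiv_within U f2 i x l2 ->
  has_pderiv_within U (fun x => g (f1 x) (f2 x)) i x (lx * l1 + ly * l2).
Proof.
  intros Hg H1 H2 eps He.
  set (M := Rabs l1 + Rabs l2 + 1).
  set (N := Rabs lx + Rabs ly + 1).
  assert (HM : 0 < M) by (unfold M; generalize (Rabs_pos l1), (Rabs_pos l2); lra).
  assert (HN : 0 < N) by (unfold N; generalize (Rabs_pos lx), (Rabs_pos ly); lra).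
  assert (He1 : 0 < eps / (2 * M)) by (apply Rdiv_lt_0_compat; lra).
  assert (He2 : 0 < eps / (2 * N)) by (apply Rdiv_lt_0_compat; lra).
  destruct (Hg (mkposreal _ He1)) as [d Hd]; simpl in Hd.
  set (e := Rmin 1 (eps / (2 * N))).
  assert (Hee : 0 < e) by (apply Rmin_pos; lra).
  destruct (H1 e Hee) as [d1 [D1 K1]].
  destruct (H2 e Hee) as [d2 [D2 K2]].
  assert (D3 : 0 < d / M) by (apply Rdiv_lt_0_compat; auto; apply cond_pos).
  exists (Rmin (d / M) (Rmin d1 d2)); split; [repeat apply Rmin_pos; auto|].
  intros h h0 hd Uh.
  assert (hd1 : Rabs h < d1)
    by (eapply Rlt_le_trans; [exact hd|]; eapply Rle_trans; [apply Rmin_r|apply Rmin_l]).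
  assert (hd2 : Rabs h < d2)
    by (eapply Rlt_le_trans; [exact hd|]; eapply Rle_trans; [apply Rmin_r|apply Rmin_r]).
  assert (hd3 : Rabs h < d / M) by (eapply Rlt_le_trans; [exact hd|]; apply Rmin_l).
  specialize (K1 h h0 hd1 Uh); specialize (K2 h h0 hd2 Uh).
  set (q1 := (f1 (upd x i (x i + h)) - f1 x) / h) in *.
  set (q2 := (f2 (upd x i (x i + h)) - f2 x) / h) in *.
  assert (E1 : f1 (upd x i (x i + h)) - f1 x = q1 * h) by (unfold q1; field; auto).
  assert (E2 : f2 (upd x i (x i + h)) - f2 x = q2 * h) by (unfold q2; field; auto).
  assert (e1 : e <= 1) by apply Rmin_l.
  assert (e2 : e <= eps / (2 * N)) by apply Rmin_r.
  assert (B1 : Rabs q1 <= M).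
  { replace q1 with ((q1 - l1) + l1) by ring.
    eapply Rle_trans; [apply Rabs_triang|]; unfold M; generalize (Rabs_pos l2); lra. }
  assert (B2 : Rabs q2 <= M).
  { replace q2 with ((q2 - l2) + l2) by ring.
    eapply Rle_trans; [apply Rabs_triang|]; unfold M; generalize (Rabs_pos l1); lra. }
  assert (hM : Rabs h * M < d).
  { apply Rmult_lt_reg_r with (/ M); [now apply Rinv_0_lt_compat|].
    replace (Rabs h * M * / M) with (Rabs h) by (field; lra). exact hd3. }
  assert (hp : 0 < Rabs h) by now apply Rabs_pos_lt.
  assert (G := Hd (f1 (upd x i (x i + h))) (f2 (upd x i (x i + h)))).
  rewrite E1, E2, !Rabs_mult in G.
  assert (G' := G ltac:(nra) ltac:(nra)); clear G.
  set (D := g (f1 (upd x i (x i + h))) (f2 (upd x i (x i + h))) - g (f1 x) (f2 x)) in *.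
  assert (G2 : Rabs (D / h - (lx * q1 + ly * q2)) <= eps / 2).
  { replace (D / h - (lx * q1 + ly * q2))
      with ((D - (lx * (q1 * h) + ly * (q2 * h))) * / h) by (field; auto).
    rewrite Rabs_mult, Rabs_inv.
    apply Rmult_le_reg_r with (Rabs h); auto.
    rewrite Rmult_assoc, Rinv_l, Rmult_1_r by lra.
    eapply Rle_trans; [exact G'|].
    apply Rle_trans with (eps / (2 * M) * (M * Rabs h)).
    - apply Rmult_le_compat_l; [lra|]. apply Rmax_lub; nra.
    - apply Req_le; field; lra. }
  replace (D / h - (lx * l1 + ly * l2))
    with ((D / h - (lx * q1 + ly * q2)) + (lx * (q1 - l1) + ly * (q2 - l2))) by ring.
  eapply Rle_lt_trans; [apply Rabs_triang|].
  assert (Rabs (lx * (q1 - l1) + ly * (q2 - l2)) < eps / 2); [|lra].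
  eapply Rle_lt_trans; [apply Rabs_triang|]; rewrite !Rabs_mult.
  apply Rle_lt_trans with ((Rabs lx + Rabs ly) * e).
  - generalize (Rabs_pos lx), (Rabs_pos ly); nra.
  - apply Rlt_le_trans with (N * e); [unfold N; lra|].
    apply Rle_trans with (N * (eps / (2 * N))); [nra|].
    apply Req_le; field; lra.
Qed.

Lemma differentiable_pt_lim_plus a b : differentiable_pt_lim Rplus a b 1 1.
Proof.
  intros eps; exists (mkposreal 1 Rlt_0_1); intros u v _ _.
  replace (u + v - (a + b) - (1 * (u - a) + 1 * (v - b))) with 0 by ring.
  rewrite Rabs_R0; apply Rmult_le_pos; [apply Rlt_le, cond_pos|].
  eapply Rle_trans; [apply Rabs_pos|apply Rmax_l].
Qed.

Lemma differentiable_pt_lim_mult a b : differentiable_pt_lim Rmult a b b a.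
Proof.
  intros eps; exists eps; intros u v Hu Hv.
  replace (u * v - a * b - (b * (u - a) + a * (v - b))) with ((u - a) * (v - b)) by ring.
  rewrite Rabs_mult; apply Rmult_le_compat; auto using Rabs_pos, Rlt_le; apply Rmax_r.
Qed.

Lemma differentiable_pt_lim_continuity_2d g a b lx ly :
  differentiable_pt_lim g a b lx ly -> continuity_2d_pt g a b.
Proof. intros H; apply differentiable_continuity_pt; now exists lx, ly. Qed.

Lemma Ck_plus n U k : forall f g, Ck n k U f -> Ck n k U g -> Ck n k U (fun x => f x + g x).
Proof.
  assert (C : forall f g, cont_on n U f -> cont_on n U g -> cont_on n U (fun x => f x + g x)).
  { intros f g; apply cont_on_comp2; intros.
    eapply differentiable_pt_lim_continuity_2d, differentiable_pt_lim_plus. }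
  induction k as [|k IH]; intros f g [F1 F2] [G1 G2]; split; auto.
  intros i Hi; destruct (F2 i Hi) as [f' [Df Cf]], (G2 i Hi) as [g' [Dg Cg]].
  exists (fun x => f' x + g' x); split; auto.
  intros x Ux; replace (f' x + g' x) with (1 * f' x + 1 * g' x) by ring.
  apply has_pderiv_within_comp2; auto using differentiable_pt_lim_plus.
Qed.

Lemma Ck_mult n U k : forall f g, Ck n k U f -> Ck n k U g -> Ck n k U (fun x => f x * g x).
Proof.
  assert (C : forall f g, cont_on n U f -> cont_on n U g -> cont_on n U (fun x => f x * g x)).
  { intros f g; apply cont_on_comp2; intros.
    eapply differentiable_pt_lim_continuity_2d, differentiable_pt_lim_mult. }
  induction k as [|k IH]; intros f g Hf Hg.
  { split; auto; apply C; eapply Ck_cont; eassumption. }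
  assert (Hf' := Ck_S _ _ _ _ Hf); assert (Hg' := Ck_S _ _ _ _ Hg).
  destruct Hf as [F1 F2], Hg as [G1 G2]; split; auto.
  intros i Hi; destruct (F2 i Hi) as [f' [Df Cf]], (G2 i Hi) as [g' [Dg Cg]].
  exists (fun x => g x * f' x + f x * g' x); split; auto using Ck_plus.
  intros x Ux; apply has_pderiv_within_comp2; auto using differentiable_pt_lim_mult.
Qed.

(** One rung of the ladder: order [S k] of the composite costs only order [k] of the composed
    partial derivatives [ga], [gb]. Every induction on the order of smoothness of a composite below
    goes through this step. *)
Lemma Ck_comp2 n U k g ga gb f1 f2 :
  (forall x, U x -> differentiable_pt_lim g (f1 x) (f2 x) (ga (f1 x) (f2 x)) (gb (f1 x) (f2 x))) ->
  Ck n (S k) U f1 -> Ck n (S k) U f2 ->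
  Ck n k U (fun x => ga (f1 x) (f2 x)) -> Ck n k U (fun x => gb (f1 x) (f2 x)) ->
  Ck n (S k) U (fun x => g (f1 x) (f2 x)).
Proof.
  intros Hg [C1 D1] [C2 D2] Ha Hb; split.
  - apply cont_on_comp2; auto; intros.
    eapply differentiable_pt_lim_continuity_2d; eauto.
  - intros i Hi; destruct (D1 i Hi) as [f1' [E1 K1]], (D2 i Hi) as [f2' [E2 K2]].
    exists (fun x => ga (f1 x) (f2 x) * f1' x + gb (f1 x) (f2 x) * f2' x).
    split; auto using Ck_plus, Ck_mult.
    intros x Ux; apply has_pderiv_within_comp2; auto.
Qed.

(* The second premise says that [g'] is smoothly expressible through [g]; all
   orders of smoothness of [g o f] then follow by bootstrapping. *)
Lemma Ck_comp1 n U (g g' : R -> R) f :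
  (forall x, U x -> is_derive g (f x) (g' (f x))) ->
  (forall k, Ck n k U f -> Ck n k U (fun x => g (f x)) -> Ck n k U (fun x => g' (f x))) ->
  forall k, Ck n k U f -> Ck n k U (fun x => g (f x)).
Proof.
  intros Hg Hb.
  assert (D : forall x, U x ->
    differentiable_pt_lim (fun u _ => g u) (f x) (f x) (g' (f x)) 0).
  { intros x Ux; apply differentiable_pt_lim_proj1_0; apply is_derive_Reals; auto. }
  induction k as [|k IH]; intros Hf.
  - split; auto. apply (cont_on_comp2 n U (fun u _ => g u) f f); eauto using Ck_cont.
    intros; eapply differentiable_pt_lim_continuity_2d; auto.
  - apply (Ck_comp2 n U k (fun u _ => g u) (fun u _ => g' u) (fun _ _ => 0) f f);
      auto using Ck_const, Ck_S.
Qed.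

Lemma Ck_opp n U k f : Ck n k U f -> Ck n k U (fun x => - f x).
Proof.
  intros H; apply Ck_ext with (fun x => (-1) * f x); [intros; ring|].
  auto using Ck_mult, Ck_const.
Qed.

Lemma Ck_minus n U k f g : Ck n k U f -> Ck n k U g -> Ck n k U (fun x => f x - g x).
Proof. intros; apply Ck_plus; auto using Ck_opp. Qed.

Lemma Ck_pow n U k f m : Ck n k U f -> Ck n k U (fun x => f x ^ m).
Proof. intros H; induction m; simpl; auto using Ck_const, Ck_mult. Qed.

Lemma Ck_inv n U k f :
  (forall x, U x -> f x <> 0) -> Ck n k U f -> Ck n k U (fun x => / f x).
Proof.
  intros H; revert k.
  apply Ck_comp1 with (g' := fun t => - (/ t * / t)).
  - intros x Ux; auto_derive; [auto|field; auto].
  - auto using Ck_opp, Ck_mult.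
Qed.

Lemma Ck_div n U k f g :
  (forall x, U x -> g x <> 0) -> Ck n k U f -> Ck n k U g -> Ck n k U (fun x => f x / g x).
Proof. intros; apply Ck_mult; auto using Ck_inv. Qed.

Lemma Ck_sqrt n U k f :
  (forall x, U x -> 0 < f x) -> Ck n k U f -> Ck n k U (fun x => sqrt (f x)).
Proof.
  intros H; revert k.
  apply Ck_comp1 with (g' := fun t => / (2 * sqrt t)).
  - intros x Ux; auto_derive; [auto|]. field. generalize (sqrt_lt_R0 _ (H x Ux)); lra.
  - intros; apply Ck_inv; auto using Ck_mult, Ck_const.
    intros x Ux; generalize (sqrt_lt_R0 _ (H x Ux)); lra.
Qed.

Lemma Ck_ln n U k f :
  (forall x, U x -> 0 < f x) -> Ck n k U f -> Ck n k U (fun x => ln (f x)).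
Proof.
  intros H; revert k.
  apply Ck_comp1 with (g' := fun t => / t).
  - intros x Ux; auto_derive; [auto|]. field. generalize (H x Ux); lra.
  - intros; apply Ck_inv; auto. intros x Ux; generalize (H x Ux); lra.
Qed.

Lemma cosh_pos x : 0 < cosh x.
Proof. unfold cosh; generalize (exp_pos x), (exp_pos (- x)); lra. Qed.

Lemma cosh2_sinh2 x : cosh x ^ 2 - sinh x ^ 2 = 1.
Proof.
  unfold cosh, sinh. assert (exp x * exp (- x) = 1).
  { rewrite <- exp_plus, Rplus_opp_r; apply exp_0. }
  nra.
Qed.

Lemma is_derive_sinh x : is_derive sinh x (cosh x).
Proof. apply is_derive_Reals, derivable_pt_lim_sinh. Qed.

Lemma is_derive_cosh x : is_derive cosh x (sinh x).
Proof. apply is_derive_Reals, derivable_pt_lim_cosh. Qed.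

Lemma is_derive_tanh x : is_derive tanh x (1 - tanh x ^ 2).
Proof.
  unfold tanh; evar_last.
  apply is_derive_div; [apply is_derive_sinh|apply is_derive_cosh|].
  generalize (cosh_pos x); lra.
  generalize (cosh_pos x) (cosh2_sinh2 x); intros; unfold minus, plus, opp, scal, mult; simpl.
  field_simplify; try lra. 
Qed.

Definition lcosh (x : R) : R := ln (cosh x).

Lemma is_derive_lcosh x : is_derive lcosh x (tanh x).
Proof.
  unfold lcosh, tanh; evar_last.
  apply (is_derive_comp ln cosh); [|apply is_derive_cosh].
  apply is_derive_Reals, derivable_pt_lim_ln, cosh_pos.
  reflexivity.
Qed.

Lemma Ck_tanh n U k f : Ck n k U f -> Ck n k U (fun x => tanh (f x)).
Proof.
  revert k; apply Ck_comp1 with (g' := fun t => 1 - tanh t ^ 2).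
  - intros; apply is_derive_tanh.
  - intros; apply Ck_minus; [apply Ck_const|now apply Ck_pow].
Qed.

Lemma Ck_lcosh n U k f : Ck n k U f -> Ck n k U (fun x => lcosh (f x)).
Proof.
  revert k; apply Ck_comp1 with (g' := tanh).
  - intros; apply is_derive_lcosh.
  - intros; now apply Ck_tanh.
Qed.

(** * The implicit function theorem *)

Lemma is_derive_continuity_pt (f : R -> R) x l : is_derive f x l -> continuity_pt f x.
Proof.
  intros H; apply continuity_pt_filterlim, (ex_derive_continuous f x); now exists l.
Qed.

(** Continuity is asked on the closed interval and the derivative only inside, so that functions
    such as [tanhc], for which only continuity is established at 0, can be compared up to 0. *)
Lemma derive_neg_decreasing (f df : R -> R) (a b : R) :
  a < b -> (forall x, a <= x <= b -> continuity_pt f x) ->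
  (forall x, a < x < b -> is_derive f x (df x)) ->
  (forall x, a < x < b -> df x < 0) -> f b < f a.
Proof.
  intros ab C D N.
  assert (D' : forall c, a < c < b -> derivable_pt f c).
  { intros c Hc; exists (df c); apply is_derive_Reals; auto. }
  destruct (MVT f id a b D' (fun c _ => derivable_pt_id c) ab C) as [c [P E]].
  { intros; apply derivable_continuous_pt, derivable_pt_id. }
  rewrite derive_pt_id in E; unfold id in E.
  replace (derive_pt f c (D' c P)) with (df c) in E.
  - specialize (N c P); nra.
  - symmetry; apply derive_pt_eq_0, is_derive_Reals; auto.
Qed.

Lemma derive_pos_increasing (f df : R -> R) (a b : R) :
  a < b -> (forall x, a <= x <= b -> continuity_pt f x) ->
  (forall x, a < x < b -> is_derive f x (df x)) ->
  (forall x, a < x < b -> 0 < df x) -> f a < f b.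
Proof.
  intros ab C D N.
  assert (H := derive_neg_decreasing (fun x => - f x) (fun x => - df x) a b ab).
  apply Ropp_lt_cancel, H.
  - intros; apply continuity_pt_opp; auto.
  - intros; apply (is_derive_opp f); auto.
  - intros x Hx; specialize (N x Hx); lra.
Qed.

(** The entry point for the partial derivatives of the gap functions: their formulas extend past the
    boundary of [U], and a two-sided derivative restricts to any domain. *)
Lemma has_pderiv_within_derive U f i x l :
  is_derive (fun t => f (upd x i t)) (x i) l -> has_pderiv_within U f i x l.
Proof.
  intros H eps He; apply is_derive_Reals in H.
  destruct (H eps He) as [d Hd]; exists d; split; [apply cond_pos|].
  intros h h0 hd _; specialize (Hd h h0 hd); now rewrite upd_same in Hd.
Qed.

(** [F x] is positive at [phi x - e] and negative at [phi x + e]. Both signs persist for nearby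
    parameters [y], and the strict decrease of [F y] then traps its zero [phi y] between these two
    points. *)
Lemma implicit_cont n U (F : (nat -> R) -> R -> R) phi :
  (forall x, U x -> 0 < phi x /\ F x (phi x) = 0) ->
  (forall x y z, U x -> 0 < y < z -> F x z < F x y) ->
  (forall y, 0 < y -> cont_on n U (fun x => F x y)) ->
  cont_on n U phi.
Proof.
  intros H0 Hd Hc x Ux eps He.
  destruct (H0 x Ux) as [P0 Z0].
  (* The minimum with [phi x], halved, keeps [phi x - e] positive, where [F] is controlled. *)
  set (e := Rmin eps (phi x) / 2).
  assert (B : 0 < e /\ e < eps /\ e < phi x).
  { unfold e; assert (0 < Rmin eps (phi x)) by now apply Rmin_pos.
    generalize (Rmin_l eps (phi x)), (Rmin_r eps (phi x)); lra. }
  assert (F1 : 0 < F x (phi x - e)) by (rewrite <- Z0; apply Hd; auto; lra).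
  assert (F2 : F x (phi x + e) < 0) by (rewrite <- Z0; apply Hd; auto; lra).
  destruct (Hc (phi x - e) ltac:(lra) x Ux _ F1) as [d1 [D1 K1]].
  destruct (Hc (phi x + e) ltac:(lra) x Ux (- F x (phi x + e)) ltac:(lra)) as [d2 [D2 K2]].
  exists (Rmin d1 d2); split; [now apply Rmin_pos|].
  intros y Uy Hy.
  assert (G1 : 0 < F y (phi x - e)).
  { specialize (K1 y Uy). apply Rabs_def2 in K1; [lra|].
    intros i Hi; eapply Rlt_le_trans; [now apply Hy|apply Rmin_l]. }
  assert (G2 : F y (phi x + e) < 0).
  { specialize (K2 y Uy). apply Rabs_def2 in K2; [lra|].
    intros i Hi; eapply Rlt_le_trans; [now apply Hy|apply Rmin_r]. }
  destruct (H0 y Uy) as [P1 Z1].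
  apply Rabs_def1.
  - apply Rnot_le_lt; intros C.
    assert (F y (phi y) < F y (phi x + e)) by (apply Hd; auto; lra). lra.
  - apply Rnot_le_lt; intros C.
    assert (F y (phi x - e) < F y (phi y)) by (apply Hd; auto; lra). lra.
Qed.

(** Both [F z (phi z)] and [F x (phi x)] vanish. Inserting [F z (phi x)] and applying the mean value
    theorem to [F z] alone, at the moved parameter [z], gives [F z (phi x) - F x (phi x) = - Fy z c
    * (phi z - phi x)]. Dividing by [h] and letting [c] tend to [phi x] yields the quotient. *)
Lemma implicit_pderiv n U (F Fy : (nat -> R) -> R -> R) phi i x l :
  (i < n)%nat -> U x -> cont_on n U phi ->
  (forall z, U z -> 0 < phi z /\ F z (phi z) = 0) ->
  (forall z y, U z -> 0 < y -> is_derive (F z) y (Fy z y)) ->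
  has_pderiv_within U (fun z => F z (phi x)) i x l ->
  Fy x (phi x) <> 0 ->
  (forall eps, 0 < eps -> exists d, 0 < d /\ forall z y, U z -> 0 < y ->
     near n x z d -> Rabs (y - phi x) < d -> Rabs (Fy z y - Fy x (phi x)) < eps) ->
  has_pderiv_within U phi i x (- l / Fy x (phi x)).
Proof.
  intros Hi Ux Cphi H0 HD Hl Hn HC eps He.
  assert (C2 : continuity_2d_pt (fun u v => - u * / v) l (Fy x (phi x))).
  { apply continuity_2d_pt_mult.
    - apply continuity_2d_pt_opp, continuity_2d_pt_id1.
    - apply continuity_2d_pt_inv; auto; apply continuity_2d_pt_id2. }
  destruct (C2 (mkposreal eps He)) as [d Hd]; simpl in Hd.
  destruct (Hl d (cond_pos d)) as [d1 [D1 K1]].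
  (* Staying within [Rabs (Fy x (phi x))] of [Fy x (phi x)] forces [Fy z c] to be nonzero. *)
  destruct (HC (Rmin d (Rabs (Fy x (phi x)))) ) as [d2 [D2 K2]].
  { apply Rmin_pos; [apply cond_pos|now apply Rabs_pos_lt]. }
  destruct (Cphi x Ux d2 D2) as [d3 [D3 K3]].
  exists (Rmin d1 (Rmin d2 d3)); split; [repeat apply Rmin_pos; auto|].
  intros h h0 hd Uh.
  assert (h1 : Rabs h < d1) by (eapply Rlt_le_trans; [exact hd|apply Rmin_l]).
  assert (h2 : Rabs h < d2)
    by (eapply Rlt_le_trans; [exact hd|]; eapply Rle_trans; [apply Rmin_r|apply Rmin_l]).
  assert (h3 : Rabs h < d3)
    by (eapply Rlt_le_trans; [exact hd|]; eapply Rle_trans; [apply Rmin_r|apply Rmin_r]).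
  set (z := upd x i (x i + h)) in *.
  assert (N : forall e, Rabs h < e -> near n x z e).
  { intros e Hhe j _; unfold z; destruct (Nat.eq_dec j i) as [->|J].
    - rewrite upd_eq; now replace (x i + h - x i) with h by ring.
    - rewrite upd_neq, Rminus_diag, Rabs_R0 by auto.
      eapply Rle_lt_trans; [apply Rabs_pos|exact Hhe]. }
  specialize (K1 h h0 h1 Uh); fold z in K1.
  specialize (K3 z Uh (N _ h3)).
  destruct (H0 x Ux) as [Px Zx], (H0 z Uh) as [Pz Zz].
  destruct (MVT_gen (F z) (phi x) (phi z) (Fy z)) as [c [Hc E]].
  { intros y Hy; apply HD; auto. eapply Rlt_trans; [|apply Hy]. now apply Rmin_pos. }
  { intros y Hy; eapply is_derive_continuity_pt, HD; auto.
    eapply Rlt_le_trans; [|apply Hy]. now apply Rmin_pos. }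
  assert (c0 : 0 < c) by (eapply Rlt_le_trans; [|apply Hc]; now apply Rmin_pos).
  assert (cx : Rabs (c - phi x) < d2).
  { eapply Rle_lt_trans; [|exact K3].
    destruct (Rle_dec (phi x) (phi z)) as [L|L].
    - rewrite Rmin_left, Rmax_right in Hc by lra. rewrite !Rabs_pos_eq by lra; lra.
    - rewrite Rmin_right, Rmax_left in Hc by lra. rewrite !Rabs_left1 by lra; lra. }
  specialize (K2 z c Uh c0 (N _ h2) cx).
  assert (K2' : Rabs (Fy z c - Fy x (phi x)) < d)
    by (eapply Rlt_le_trans; [exact K2|apply Rmin_l]).
  assert (Nc : Fy z c <> 0).
  { intros Z; rewrite Z in K2. apply (Rlt_irrefl (Rabs (Fy x (phi x)))).
    eapply Rlt_le_trans; [|apply Rmin_r with (x := d)].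
    now rewrite Rminus_0_l, Rabs_Ropp in K2. }
  specialize (Hd _ _ K1 K2').
  replace ((phi z - phi x) / h) with (- ((F z (phi x) - F x (phi x)) / h) * / Fy z c); auto.
  rewrite Zz in E. rewrite Zx.
  replace (F z (phi x)) with (- (Fy z c * (phi z - phi x))) by lra.
  field; auto.
Qed.

(** Coordinate [n] is a spare one, invisible to [U] and [Fy] by the first two premises. It stores
    the unknown, so that joint continuity of [Fy] in parameters and unknown becomes a
    [cont_on (S n)] statement. The last premise is the bootstrap: along the graph of [phi], all
    partial derivatives are as smooth as [phi]. *)
Lemma implicit_Smooth n U (F Fy : (nat -> R) -> R -> R) (Fi : nat -> (nat -> R) -> R -> R) phi :
  (forall x y, U x -> U (upd x n y)) ->
  (forall x y z, Fy (upd x n y) z = Fy x z) ->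
  (forall x, U x -> 0 < phi x /\ F x (phi x) = 0) ->
  (forall x y, U x -> 0 < y -> is_derive (F x) y (Fy x y) /\ Fy x y < 0) ->
  (forall x i, U x -> (i < n)%nat ->
     has_pderiv_within U (fun z => F z (phi x)) i x (Fi i x (phi x))) ->
  (forall y, 0 < y -> cont_on n U (fun x => F x y)) ->
  cont_on (S n) (fun z => U z /\ 0 < z n) (fun z => Fy z (z n)) ->
  (forall k, Ck n k U phi -> Ck n k U (fun x => Fy x (phi x)) /\
     forall i, (i < n)%nat -> Ck n k U (fun x => Fi i x (phi x))) ->
  Smooth n U phi /\
  (forall x i, U x -> (i < n)%nat ->
     has_pderiv_within U phi i x (- Fi i x (phi x) / Fy x (phi x))).
Proof.
  intros HU HFu H0 HD Hi HC HCy Hcl.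
  assert (Cphi : cont_on n U phi).
  { apply implicit_cont with F; auto.
    intros x y z Ux Hyz; apply derive_neg_decreasing with (Fy x); try lra.
    - intros t Ht; eapply is_derive_continuity_pt, HD; auto; lra.
    - intros t Ht; apply HD; auto; lra.
    - intros t Ht; apply HD; auto; lra. }
  assert (P : forall x i, U x -> (i < n)%nat ->
     has_pderiv_within U phi i x (- Fi i x (phi x) / Fy x (phi x))).
  { intros x i Ux Hin; apply implicit_pderiv with n F; auto.
    - intros; now apply HD.
    - apply Rlt_not_eq, HD; auto; now apply H0.
    - intros eps He.
      destruct (HCy (upd x n (phi x))) with (eps := eps) as [d [Hd K]]; auto.
      { rewrite upd_eq; split; auto; now apply H0. }
      exists d; split; auto; intros z y Uz Hy Hz Hyx.
      specialize (K (upd z n y)); rewrite !upd_eq, !HFu in K; apply K; auto.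
      intros j Hj; destruct (Nat.eq_dec j n) as [->|J].
      + now rewrite !upd_eq.
      + rewrite !upd_neq by auto; apply Hz; lia. }
  split; auto.
  intros k; induction k as [|k IH]; split; auto.
  intros i Hin; destruct (Hcl k IH) as [K1 K2].
  exists (fun x => - Fi i x (phi x) / Fy x (phi x)); split; auto.
  apply Ck_div; auto using Ck_opp.
  intros x Ux; apply Rlt_not_eq, HD; auto; now apply H0.
Qed.

(** Transfers smoothness on the half-line to the iterated derivatives [Derive_n]. The C^k rules
    applied to a closed formula thus give derivatives of all orders without computing them. *)
Lemma Smooth_Derive_n (f : R -> R) :
  Smooth 1 (fun x => 0 < x 0%nat) (fun x => f (x 0%nat)) ->
  forall j u, 0 < u -> is_derive (Derive_n f j) u (Derive_n f (S j) u).
Proof.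
  set (U := fun x : nat -> R => 0 < x 0%nat).
  assert (Step : forall h : R -> R, Smooth 1 U (fun x => h (x 0%nat)) ->
    (forall u, 0 < u -> is_derive h u (Derive h u)) /\
    Smooth 1 U (fun x => Derive h (x 0%nat))).
  { intros h Hh.
    assert (K : forall g : (nat -> R) -> R,
      (forall x, U x -> has_pderiv_within U (fun x => h (x 0%nat)) 0 x (g x)) ->
      forall x, U x -> is_derive h (x 0%nat) (g x)).
    { intros g Hg x Ux; apply is_derive_Reals; intros eps He.
      destruct (Hg x Ux eps He) as [d [Hd K]].
      (* Increments smaller than [x 0] stay in the half-line, so the derivative within [U] is an
         ordinary derivative. *)
      assert (Hm : 0 < Rmin d (x 0%nat)) by now apply Rmin_pos.
      exists (mkposreal _ Hm); intros t t0 Ht; simpl in Ht.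
      specialize (K t t0); rewrite upd_eq in K; apply K.
      - eapply Rlt_le_trans; [exact Ht|apply Rmin_l].
      - unfold U; rewrite upd_eq.
        assert (Rabs t < x 0%nat) by (eapply Rlt_le_trans; [exact Ht|apply Rmin_r]).
        apply Rabs_def2 in H; lra. }
    split.
    - intros u Hu. destruct (Hh 1%nat) as [_ H1].
      destruct (H1 0%nat ltac:(lia)) as [g [Hg _]].
      apply Derive_correct; exists (g (fun _ => u)).
      exact (K g Hg (fun _ => u) Hu).
    - intros k; destruct (Hh (S k)) as [_ H1].
      destruct (H1 0%nat ltac:(lia)) as [g [Hg Cg]].
      apply Ck_ext with g; auto.
      intros x Ux; symmetry; apply is_derive_unique; auto. }
  intros Hf.
  assert (A : forall j, Smooth 1 U (fun x => Derive_n f j (x 0%nat))).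
  { induction j as [|j IH]; auto. now apply Step. }
  intros j u Hu; now apply Step.
Qed.

(** * Integrals of [c j (t ^ 2 + q)] for a sequence [c] closed under differentiation *)

Section Primitive_family.
Variable c : nat -> R -> R.
Hypothesis Hc : forall j u, 0 < u -> is_derive (c j) u (c (S j) u).

Definition prim (j : nat) (a q : R) : R := RInt (fun t => c j (t ^ 2 + q)) 0 a.

Lemma prim_continuous j t q : 0 < q -> continuous (fun t => c j (t ^ 2 + q)) t.
Proof.
  intros Hq; apply (continuous_comp (fun t => t ^ 2 + q) (c j)).
  - apply (ex_derive_continuous (V:=R_NormedModule)); auto_derive; auto.
  - apply (ex_derive_continuous (V:=R_NormedModule)); eexists; apply Hc; nra.
Qed.

Lemma prim_ex_RInt j a b q : 0 < q -> ex_RInt (fun t => c j (t ^ 2 + q)) a b.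
Proof. intros Hq; apply (ex_RInt_continuous (V:=R_CompleteNormedModule)); intros; now apply prim_continuous. Qed.

Lemma is_derive_prim_l j a q : 0 < q -> is_derive (fun a => prim j a q) a (c j (a ^ 2 + q)).
Proof.
  intros Hq; apply (is_derive_RInt (fun t => c j (t ^ 2 + q)) (fun b => prim j b q) 0).
  - apply filter_forall; intros b; apply (RInt_correct (V:=R_CompleteNormedModule)); now apply prim_ex_RInt.
  - now apply prim_continuous.
Qed.

Lemma continuity_2d_c j a q : 0 < q -> continuity_2d_pt (fun u v => c j (u ^ 2 + v)) a q.
Proof.
  intros Hq; apply (continuity_1d_2d_pt_comp (c j)).
  - eapply is_derive_continuity_pt, Hc; nra.
  - apply continuity_2d_pt_plus; [|apply continuity_2d_pt_id2].
    apply continuity_1d_2d_pt_comp with (f := fun t => t ^ 2);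
      [apply derivable_continuous_pt, derivable_pt_pow|apply continuity_2d_pt_id1].
Qed.

Lemma locally_pos q : 0 < q -> locally q (fun x => 0 < x).
Proof.
  intros Hq; exists (mkposreal q Hq); intros y Hy.
  apply Rabs_def2 in Hy; simpl in Hy; unfold minus, plus, opp in Hy; simpl in Hy; lra.
Qed.

Lemma is_derive_c_comp j t q : 0 < q -> is_derive (fun q => c j (t ^ 2 + q)) q (c (S j) (t ^ 2 + q)).
Proof.
  intros Hq. rewrite <- (Rmult_1_l (c (S j) _)).
  apply (is_derive_comp (c j) (fun q => t ^ 2 + q)).
  - apply Hc; nra.
  - auto_derive; auto.
Qed.

Lemma is_derive_prim_r j a q : 0 < q -> is_derive (fun q => prim j a q) q (prim (S j) a q).
Proof.
  intros Hq.
  replace (prim (S j) a q)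
    with (RInt (fun t => Derive (fun q => c j (t ^ 2 + q)) q) 0 a).
  2:{ apply RInt_ext; intros t _; now apply is_derive_unique, is_derive_c_comp. }
  apply (is_derive_RInt_param (fun q t => c j (t ^ 2 + q))).
  - eapply filter_imp; [|apply locally_pos, Hq].
    intros y Hy t _; eexists; now apply is_derive_c_comp.
  - intros t _.
    apply continuity_2d_pt_ext_loc with (fun u v => c (S j) (v ^ 2 + u)).
    + exists (mkposreal q Hq); intros u v Hu _; symmetry.
      apply is_derive_unique, is_derive_c_comp.
      apply Rabs_def2 in Hu; simpl in Hu; lra.
    + intros eps; destruct (continuity_2d_c (S j) t q Hq eps) as [d Hd].
      exists d; intros u v Hu Hv; auto.
  - eapply filter_imp; [|apply locally_pos, Hq]. intros y Hy; now apply prim_ex_RInt.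
Qed.

(** Total differentiability follows from the partial derivative in [a], known near the point and
    jointly continuous, together with the partial derivative in [q] at the point. *)
Lemma differentiable_prim j a q :
  0 < q -> differentiable_pt_lim (prim j) a q (c j (a ^ 2 + q)) (prim (S j) a q).
Proof.
  intros Hq; apply filterdiff_differentiable_pt_lim.
  apply (is_derive_filterdiff (prim j) a q (fun a q => c j (a ^ 2 + q)) (prim (S j) a q)).
  - assert (P : 0 < q) by exact Hq.
    exists (mkposreal q P); intros [u v] [_ Hv]; simpl in *.
    apply is_derive_prim_l. apply Rabs_def2 in Hv; unfold minus, plus, opp in Hv; simpl in Hv; lra.
  - now apply is_derive_prim_r.
  - now apply (continuity_2d_pt_filterlim (fun u v => c j (u ^ 2 + v))), continuity_2d_c.
Qed.

Lemma Ck_family n U f : (forall x, U x -> 0 < f x) ->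
  forall k j, Ck n k U f -> Ck n k U (fun x => c j (f x)).
Proof.
  intros Hf.
  assert (D : forall j x, U x -> differentiable_pt_lim (fun u _ => c j u) (f x) (f x) (c (S j) (f x)) 0).
  { intros j x Ux; apply differentiable_pt_lim_proj1_0, is_derive_Reals; auto. }
  induction k as [|k IH]; intros j Cf.
  - split; auto. apply (cont_on_comp2 n U (fun u _ => c j u) f f); eauto using Ck_cont.
    intros; eapply differentiable_pt_lim_continuity_2d; auto.
  - apply (Ck_comp2 n U k (fun u _ => c j u) (fun u _ => c (S j) u) (fun _ _ => 0) f f);
      auto using Ck_const, Ck_S.
Qed.

(** The induction on [k] treats all [j] at once: differentiating in [q] raises [j], and
    differentiating in [a] leaves the integral and falls under [Ck_family]. *)
Lemma Ck_prim n U f q : (forall x, U x -> 0 < q x) ->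
  forall k j, Ck n k U f -> Ck n k U q -> Ck n k U (fun x => prim j (f x) (q x)).
Proof.
  intros Hq; induction k as [|k IH]; intros j Cf Cq.
  - split; auto. apply cont_on_comp2; eauto using Ck_cont.
    intros; eapply differentiable_pt_lim_continuity_2d, differentiable_prim; auto.
  - apply Ck_comp2 with (ga := fun a q => c j (a ^ 2 + q)) (gb := prim (S j));
      auto using Ck_S, differentiable_prim.
    apply Ck_family with (f := fun x => f x ^ 2 + q x).
    + intros x Ux; specialize (Hq x Ux); nra.
    + auto using Ck_plus, Ck_pow, Ck_S.
Qed.
End Primitive_family.

(** * Estimates for tanh and its primitives *)

Lemma is_derive_Rid (x : R) : is_derive (fun t : R => t) x 1.
Proof. exact (is_derive_id x). Qed.

Lemma tanh_0 : tanh 0 = 0.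
Proof. unfold tanh; rewrite sinh_0; unfold Rdiv; ring. Qed.

Lemma sinh_pos x : 0 < x -> 0 < sinh x.
Proof. intros; rewrite <- sinh_0; now apply sinh_lt. Qed.

Lemma tanh_pos x : 0 < x -> 0 < tanh x.
Proof. intros; apply Rdiv_lt_0_compat; [now apply sinh_pos|apply cosh_pos]. Qed.

Lemma tanh_bound x : -1 < tanh x < 1.
Proof.
  unfold tanh; assert (C := cosh_pos x).
  assert (- cosh x < sinh x < cosh x).
  { unfold cosh, sinh; generalize (exp_pos x), (exp_pos (- x)); lra. }
  split; apply Rmult_lt_reg_r with (cosh x); auto; unfold Rdiv;
    rewrite ?Rmult_assoc, Rinv_l by lra; lra.
Qed.

Lemma cosh_gt_1 x : 0 < x -> 1 < cosh x.
Proof. intros H; generalize (sinh_pos x H), (cosh_pos x), (cosh2_sinh2 x); nra. Qed.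

Lemma sinh_gt x : 0 < x -> x < sinh x.
Proof.
  intros Hx.
  assert (0 - sinh 0 > x - sinh x); [|rewrite sinh_0 in H; lra].
  apply (derive_neg_decreasing (fun x => x - sinh x) (fun x => 1 - cosh x)); auto.
  - intros t _; apply is_derive_continuity_pt with (1 - cosh t).
    apply (is_derive_minus (fun x => x) sinh); [apply is_derive_Rid|apply is_derive_sinh].
  - intros t _; apply (is_derive_minus (fun x => x) sinh);
      [apply is_derive_Rid|apply is_derive_sinh].
  - intros t Ht; generalize (cosh_gt_1 t ltac:(lra)); lra.
Qed.

(* The value 1 at 0 is the continuous extension. *)
Definition tanhc (z : R) : R := if Req_EM_T z 0 then 1 else tanh z / z.

Lemma tanhc_0 : tanhc 0 = 1.
Proof. unfold tanhc; destruct (Req_EM_T 0 0); congruence. Qed.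

Lemma tanhc_eq z : z <> 0 -> tanhc z = tanh z / z.
Proof. intros; unfold tanhc; destruct (Req_EM_T z 0); congruence. Qed.

Lemma is_derive_tanhc z : z <> 0 -> is_derive tanhc z ((1 - tanh z ^ 2 - tanhc z) / z).
Proof.
  intros Hz.
  apply is_derive_ext_loc with (fun z => tanh z / z).
  - assert (P : 0 < Rabs z) by now apply Rabs_pos_lt.
    exists (mkposreal _ P); intros y Hy; symmetry; apply tanhc_eq; intros ->.
    apply Rlt_irrefl with (Rabs z).
    unfold ball in Hy; simpl in Hy; unfold AbsRing_ball, abs, minus, plus, opp in Hy; simpl in Hy.
    now rewrite Rplus_0_l, Rabs_Ropp in Hy.
  - rewrite (tanhc_eq z Hz).
    evar_last; [apply is_derive_div; [apply is_derive_tanh|apply is_derive_Rid|exact Hz]|].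
    unfold one; simpl; field; auto.
Qed.

Lemma tanhc_continuity z : continuity_pt tanhc z.
Proof.
  destruct (Req_EM_T z 0) as [->|Hz].
  (* Continuity of [tanhc] at 0 is the statement that [tanh] has derivative 1 there. *)
  - assert (D := is_derive_tanh 0); rewrite tanh_0 in D; apply is_derive_Reals in D.
    intros eps He; destruct (D eps He) as [d Hd].
    exists d; split; [apply cond_pos|]; intros x [[_ Hx] Hxd].
    simpl in *; unfold Rdist in *; rewrite Rminus_0_r in Hxd.
    specialize (Hd x ltac:(auto) Hxd).
    rewrite tanhc_0, tanhc_eq by auto.
    rewrite Rplus_0_l, tanh_0, Rminus_0_r in Hd.
    now replace 1 with (1 - 0 ^ 2) by ring.
  - eapply is_derive_continuity_pt, is_derive_tanhc, Hz.
Qed.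

Lemma tanhc_pos z : 0 <= z -> 0 < tanhc z.
Proof.
  intros Hz; destruct (Req_EM_T z 0) as [->|H0].
  - rewrite tanhc_0; lra.
  - rewrite tanhc_eq by auto; apply Rdiv_lt_0_compat; [apply tanh_pos|]; lra.
Qed.

(** After clearing denominators this is [z < sinh z * cosh z]. It is the source of monotonicity in
    [D]: it makes [tanhc], and hence [gam], strictly decreasing. *)
Lemma sech2_lt_tanhc z : 0 < z -> 1 - tanh z ^ 2 < tanhc z.
Proof.
  intros Hz; rewrite tanhc_eq by lra; unfold tanh.
  assert (C := cosh_pos z); assert (I := cosh2_sinh2 z).
  assert (S := sinh_gt z Hz); assert (C1 := cosh_gt_1 z Hz).
  replace (1 - (sinh z / cosh z) ^ 2) with ((cosh z ^ 2 - sinh z ^ 2) / cosh z ^ 2)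
    by (field; lra).
  rewrite I.
  apply Rmult_lt_reg_r with (z * cosh z ^ 2); [nra|].
  replace (1 / cosh z ^ 2 * (z * cosh z ^ 2)) with z by (field; lra).
  replace (sinh z / cosh z / z * (z * cosh z ^ 2)) with (sinh z * cosh z) by (field; lra).
  nra.
Qed.

Lemma tanhc_decr a b : 0 <= a < b -> tanhc b < tanhc a.
Proof.
  intros H; apply derive_neg_decreasing with (fun z => (1 - tanh z ^ 2 - tanhc z) / z).
  - lra.
  - intros; apply tanhc_continuity.
  - intros; apply is_derive_tanhc; lra.
  - intros z Hz; generalize (sech2_lt_tanhc z ltac:(lra)); intros.
    apply Ropp_lt_cancel; rewrite Ropp_0; unfold Rdiv; rewrite Ropp_mult_distr_l.
    apply Rdiv_lt_0_compat; lra.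
Qed.

Lemma tanhc_lt_1 z : 0 < z -> tanhc z < 1.
Proof. intros; rewrite <- tanhc_0; apply tanhc_decr; lra. Qed.

Lemma tanh_lt x : 0 < x -> tanh x < x.
Proof.
  intros H; assert (K := tanhc_lt_1 x H); rewrite tanhc_eq in K by lra.
  apply Rmult_lt_reg_r with (/ x); [now apply Rinv_0_lt_compat|]. rewrite Rinv_r; lra.
Qed.

(** * The kernel tanh (sqrt u) / sqrt u and its integrals *)

Definition gam (u : R) : R := tanhc (sqrt u).

Lemma gam_eq u : 0 < u -> gam u = tanh (sqrt u) / sqrt u.
Proof. intros H; apply tanhc_eq; generalize (sqrt_lt_R0 u H); lra. Qed.

Lemma gam_pos u : 0 < gam u.
Proof. apply tanhc_pos, sqrt_pos. Qed.

Definition gam' (u : R) : R := (1 - tanh (sqrt u) ^ 2 - gam u) / (2 * u).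

Lemma is_derive_gam u : 0 < u -> is_derive gam u (gam' u).
Proof.
  intros Hu; assert (S := sqrt_lt_R0 u Hu).
  unfold gam; evar_last.
  - apply (is_derive_comp tanhc sqrt).
    + apply is_derive_tanhc; lra.
    + apply is_derive_Reals, derivable_pt_lim_sqrt, Hu.
  - unfold gam', gam, scal; simpl; unfold mult; simpl.
    replace (2 * u) with (2 * (sqrt u * sqrt u)) by (rewrite sqrt_def; lra).
    field; lra.
Qed.

Lemma gam'_neg u : 0 < u -> gam' u < 0.
Proof.
  intros Hu; assert (S := sqrt_lt_R0 u Hu).
  generalize (sech2_lt_tanhc (sqrt u) S); fold (gam u); intros.
  unfold gam'; apply Ropp_lt_cancel; rewrite Ropp_0; unfold Rdiv; rewrite Ropp_mult_distr_l.
  apply Rdiv_lt_0_compat; lra.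
Qed.

Definition gamn (j : nat) : R -> R := Derive_n gam j.

(** On the open half-line [gam] is a quotient of smooth functions, which provides every order at
    once; [gamn] stays an abstract iterated derivative, and only order one gets the formula
    [gam']. *)
Lemma gamn_derive j u : 0 < u -> is_derive (gamn j) u (gamn (S j) u).
Proof.
  intros Hu; apply Smooth_Derive_n; auto.
  intros k; apply Ck_ext with (fun x => tanh (sqrt (x 0%nat)) / sqrt (x 0%nat)).
  - intros x Hx; now rewrite gam_eq.
  - apply Ck_div.
    + intros x Hx; generalize (sqrt_lt_R0 _ Hx); lra.
    + apply Ck_tanh, Ck_sqrt; auto; apply Ck_proj; lia.
    + apply Ck_sqrt; auto; apply Ck_proj; lia.
Qed.

Lemma gamn_1 u : 0 < u -> gamn 1 u = gam' u.
Proof. intros; now apply is_derive_unique, is_derive_gam. Qed.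

Definition Psi (a q : R) : R := prim gamn 0 a q.
Definition Psi' (a q : R) : R := prim gamn 1 a q.

Lemma is_derive_Psi_l a q : 0 < q -> is_derive (fun a => Psi a q) a (gam (a ^ 2 + q)).
Proof. intros; now apply (is_derive_prim_l gamn gamn_derive 0). Qed.

Lemma is_derive_Psi_r a q : 0 < q -> is_derive (fun q => Psi a q) q (Psi' a q).
Proof. intros; now apply (is_derive_prim_r gamn gamn_derive 0). Qed.

Lemma differentiable_Psi a q : 0 < q ->
  differentiable_pt_lim Psi a q (gam (a ^ 2 + q)) (Psi' a q).
Proof. intros; now apply (differentiable_prim gamn gamn_derive 0). Qed.

Lemma is_derive_Psi'_l a q : 0 < q -> is_derive (fun a => Psi' a q) a (gam' (a ^ 2 + q)).
Proof.
  intros; rewrite <- gamn_1 by nra; now apply (is_derive_prim_l gamn gamn_derive 1).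
Qed.

Lemma Psi_0 q : Psi 0 q = 0.
Proof. apply (RInt_point (V := R_CompleteNormedModule)). Qed.

Lemma Psi'_0 q : Psi' 0 q = 0.
Proof. apply (RInt_point (V := R_CompleteNormedModule)). Qed.

(** The tool for comparing integrals over [[0, a]]: both sides vanish at 0, so an inequality between
    integrands, which are the derivatives in [a], is enough. *)
Lemma increasing_from_0 (f df : R -> R) (a : R) :
  0 < a -> (forall x, is_derive f x (df x)) -> (forall x, 0 < x -> 0 < df x) ->
  f 0 = 0 -> 0 < f a.
Proof.
  intros Ha D P <-; apply derive_pos_increasing with df; auto.
  - intros; eapply is_derive_continuity_pt, D.
  - intros x Hx; apply P; lra.
Qed.

Lemma Psi_pos a q : 0 < a -> 0 < q -> 0 < Psi a q.
Proof.
  intros Ha Hq; apply (increasing_from_0 (fun a => Psi a q) (fun a => gam (a ^ 2 + q)));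
    auto using is_derive_Psi_l, Psi_0, gam_pos.
Qed.

Lemma Psi'_neg a q : 0 < a -> 0 < q -> Psi' a q < 0.
Proof.
  intros Ha Hq; apply Ropp_lt_cancel; rewrite Ropp_0.
  apply (increasing_from_0 (fun a => - Psi' a q) (fun a => - gam' (a ^ 2 + q))); auto.
  - intros; apply (is_derive_opp (fun a => Psi' a q)); auto using is_derive_Psi'_l.
  - intros x Hx; generalize (gam'_neg (x ^ 2 + q) ltac:(nra)); lra.
  - rewrite Psi'_0; ring.
Qed.

(* The left side is the derivative of [Psi] along the scaling
   [(a, q) -> (s a, s^2 q)], up to sign the [T]-derivative of the integral term;
   as a function of [a] it is a primitive of [sech^2 (sqrt (a^2 + q))]. *)
Lemma Psi_scaling_pos a q : 0 < a -> 0 < q -> 0 < a * gam (a ^ 2 + q) + 2 * q * Psi' a q.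
Proof.
  intros Ha Hq.
  apply (increasing_from_0 (fun a => a * gam (a ^ 2 + q) + 2 * q * Psi' a q)
           (fun a => 1 - tanh (sqrt (a ^ 2 + q)) ^ 2)); auto.
  - intros x; assert (P : 0 < x ^ 2 + q) by nra. evar_last.
    + apply (is_derive_plus (fun a => a * gam (a ^ 2 + q)) (fun a => 2 * q * Psi' a q)).
      * apply (is_derive_mult (fun a => a) (fun a => gam (a ^ 2 + q))); [apply is_derive_Rid| |intros; apply Rmult_comm].
        apply (is_derive_comp gam (fun a => a ^ 2 + q)); [now apply is_derive_gam|].
        auto_derive; [auto|reflexivity].
      * apply is_derive_scal, is_derive_Psi'_l, Hq.
    + unfold gam', plus, mult, scal, one; simpl; unfold mult; simpl; field; lra.
  - intros x _; generalize (tanh_bound (sqrt (x ^ 2 + q))); nra.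
  - rewrite Psi'_0; ring.
Qed.

(** The logarithm is arsinh (a / b). Since its derivative is [gam (a ^ 2 + b ^ 2)] with [tanh]
    replaced by 1, it is what [Psi] turns into at zero temperature. *)
Lemma is_derive_asinh_l a b : 0 < b ->
  is_derive (fun a => ln ((a + sqrt (a ^ 2 + b ^ 2)) / b)) a (/ sqrt (a ^ 2 + b ^ 2)).
Proof.
  intros Hb; assert (P : 0 < a ^ 2 + b ^ 2) by nra.
  assert (S := sqrt_lt_R0 _ P); assert (E := sqrt_def _ (Rlt_le _ _ P)).
  assert (K : 0 < a + sqrt (a ^ 2 + b ^ 2)) by nra.
  simpl in *.
  auto_derive; simpl.
  - repeat split; try lra. apply Rdiv_lt_0_compat; lra.
  - field; repeat split; lra.
Qed.

Lemma asinh_0 b : 0 < b -> ln ((0 + sqrt (0 ^ 2 + b ^ 2)) / b) = 0.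
Proof.
  intros Hb; replace (0 ^ 2 + b ^ 2) with (b ^ 2) by ring.
  rewrite sqrt_pow2 by lra. replace ((0 + b) / b) with 1 by (field; lra). apply ln_1.
Qed.

Lemma Psi_lt_asinh a b : 0 < a -> 0 < b -> Psi a (b ^ 2) < ln ((a + sqrt (a ^ 2 + b ^ 2)) / b).
Proof.
  intros Ha Hb.
  apply Rminus_lt_0.
  assert (Q : 0 < b ^ 2) by nra.
  apply (increasing_from_0 (fun a => ln ((a + sqrt (a ^ 2 + b ^ 2)) / b) - Psi a (b ^ 2))
           (fun a => / sqrt (a ^ 2 + b ^ 2) - gam (a ^ 2 + b ^ 2))); auto.
  - intros x; apply (is_derive_minus (fun a => ln ((a + sqrt (a ^ 2 + b ^ 2)) / b))
      (fun a => Psi a (b ^ 2))); auto using is_derive_asinh_l, is_derive_Psi_l.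
  - intros x Hx; assert (P : 0 < x ^ 2 + b ^ 2) by nra; assert (S := sqrt_lt_R0 _ P).
    rewrite gam_eq by auto. apply Rlt_0_minus.
    generalize (tanh_bound (sqrt (x ^ 2 + b ^ 2))) (Rinv_0_lt_compat _ S); unfold Rdiv; nra.
  - rewrite asinh_0, Psi_0 by auto; ring.
Qed.

(** Equivalent to z exp (-z) < cosh z, whose left side is below 1. A rational bound is chosen
    because, divided by [z], its error is [/ z ^ 2], which is easy to integrate. *)
Lemma tanh_gt_1_inv z : 0 < z -> 1 - / z < tanh z.
Proof.
  intros Hz; unfold tanh.
  assert (C := cosh_pos z).
  assert (S := sinh_gt z Hz).
  apply Rmult_lt_reg_r with (z * cosh z); [nra|].
  replace ((1 - / z) * (z * cosh z)) with (z * cosh z - cosh z) by (field; lra).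
  replace (sinh z / cosh z * (z * cosh z)) with (z * sinh z) by (field; lra).
  assert (E : cosh z - sinh z = exp (- z)) by (unfold cosh, sinh; field).
  assert (F : z < exp z) by (generalize (exp_ineq1 z ltac:(lra)); lra).
  assert (I : exp z * exp (- z) = 1).
  { rewrite <- exp_plus, Rplus_opp_r; apply exp_0. }
  assert (C1 := cosh_gt_1 z Hz).
  generalize (exp_pos (- z)); nra.
Qed.

(** With s^2 = x^2 + b^2 the integrand satisfies tanh s / s > 1/s - 1/s^2 > 1/s - 1/b^2, and the
    constant error integrates to [a / b ^ 2]. For [a = mu / 2T] and [b = D / 2T] this is of order
    [T]. *)
Lemma Psi_gt_asinh a b : 0 < a -> 0 < b ->
  ln ((a + sqrt (a ^ 2 + b ^ 2)) / b) - a / b ^ 2 < Psi a (b ^ 2).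
Proof.
  intros Ha Hb.
  apply Rminus_lt_0.
  assert (Q : 0 < b ^ 2) by nra.
  apply (increasing_from_0 (fun a => Psi a (b ^ 2) - (ln ((a + sqrt (a ^ 2 + b ^ 2)) / b) - a / b ^ 2))
           (fun a => gam (a ^ 2 + b ^ 2) - (/ sqrt (a ^ 2 + b ^ 2) - / b ^ 2))); auto.
  - intros x; apply (is_derive_minus (fun a => Psi a (b ^ 2))
      (fun a => ln ((a + sqrt (a ^ 2 + b ^ 2)) / b) - a / b ^ 2)); [now apply is_derive_Psi_l|].
    apply (is_derive_minus (fun a => ln ((a + sqrt (a ^ 2 + b ^ 2)) / b)) (fun a => a / b ^ 2));
      [now apply is_derive_asinh_l|].
    auto_derive; [nra|field; nra].
  - intros x Hx; assert (P : 0 < x ^ 2 + b ^ 2) by nra; assert (S := sqrt_lt_R0 _ P).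
    rewrite gam_eq by auto.
    assert (E := sqrt_def _ (Rlt_le _ _ P)).
    set (s := sqrt (x ^ 2 + b ^ 2)) in *.
    assert (T := tanh_gt_1_inv s S).
    assert (I : / (s * s) < / b ^ 2) by (apply Rinv_lt_contravar; nra).
    assert (J := Rinv_0_lt_compat _ S).
    rewrite Rinv_mult in I. unfold Rdiv. nra.
  - rewrite asinh_0, Psi_0 by auto; field; lra.
Qed.

(** The value of [Psi] at [q = 0] for [a >= 0]. It is treated separately because the family [gamn]
    is differentiated only at positive arguments. *)
Definition psi (a : R) : R := RInt tanhc 0 a.

Lemma tanhc_ex_RInt a b : ex_RInt tanhc a b.
Proof.
  apply (ex_RInt_continuous (V := R_CompleteNormedModule)); intros.
  apply continuity_pt_filterlim, tanhc_continuity.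
Qed.

Lemma is_derive_psi a : is_derive psi a (tanhc a).
Proof.
  apply (is_derive_RInt tanhc psi 0).
  - apply filter_forall; intros b; apply (RInt_correct (V:=R_CompleteNormedModule)), tanhc_ex_RInt.
  - apply continuity_pt_filterlim, tanhc_continuity.
Qed.

Lemma psi_0 : psi 0 = 0.
Proof. apply (RInt_point (V := R_CompleteNormedModule)). Qed.

Lemma psi_lt a b : 0 <= a < b -> psi a < psi b.
Proof.
  intros H; apply derive_pos_increasing with tanhc; try lra.
  - intros; eapply is_derive_continuity_pt, is_derive_psi.
  - intros; apply is_derive_psi.
  - intros; apply tanhc_pos; lra.
Qed.

Lemma psi_pos a : 0 < a -> 0 < psi a.
Proof. intros; rewrite <- psi_0; apply psi_lt; lra. Qed.

Lemma psi_lt_id a : 0 < a -> psi a < a.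
Proof.
  intros Ha; apply Rminus_lt_0.
  apply (increasing_from_0 (fun a => a - psi a) (fun a => 1 - tanhc a)); auto.
  - intros; apply (is_derive_minus (fun a => a) psi); [apply is_derive_Rid|apply is_derive_psi].
  - intros x Hx; generalize (tanhc_lt_1 x Hx); lra.
  - rewrite psi_0; ring.
Qed.

(** Beyond 1 the integrand is at least [tanh 1 / x]. The resulting logarithmic growth makes [gapG]
    unbounded as [T -> 0], hence a critical temperature exists for every coupling. *)
Lemma psi_gt_ln a : 1 < a -> tanh 1 * ln a < psi a.
Proof.
  intros Ha.
  assert (K : psi 1 - tanh 1 * ln 1 < psi a - tanh 1 * ln a).
  { assert (D : forall x, 0 < x ->
      is_derive (fun a => psi a - tanh 1 * ln a) x (tanhc x - tanh 1 * / x)).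
    { intros x Hx; apply (is_derive_minus psi (fun a => tanh 1 * ln a)); [apply is_derive_psi|].
      apply is_derive_scal, is_derive_Reals, derivable_pt_lim_ln, Hx. }
    apply (derive_pos_increasing (fun a => psi a - tanh 1 * ln a)
      (fun a => tanhc a - tanh 1 * / a)); auto.
    - intros x Hx; eapply is_derive_continuity_pt, D; lra.
    - intros x Hx; apply D; lra.
    - intros x Hx; rewrite tanhc_eq by lra.
      assert (T : tanh 1 < tanh x).
      { apply derive_pos_increasing with (fun x => 1 - tanh x ^ 2); try lra.
        - intros; eapply is_derive_continuity_pt, is_derive_tanh.
        - intros; apply is_derive_tanh.
        - intros y _; generalize (tanh_bound y); nra. }
      assert (0 < / x) by (apply Rinv_0_lt_compat; lra). unfold Rdiv; nra. }
  rewrite ln_1 in K; generalize (psi_pos 1 Rlt_0_1); lra.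
Qed.

Lemma Psi_lt_psi a b : 0 < a -> 0 < b -> Psi a (b ^ 2) < psi a.
Proof.
  intros Ha Hb; apply Rminus_lt_0; assert (Q : 0 < b ^ 2) by nra.
  apply (increasing_from_0 (fun a => psi a - Psi a (b ^ 2))
           (fun a => tanhc a - gam (a ^ 2 + b ^ 2))); auto.
  - intros; apply (is_derive_minus psi (fun a => Psi a (b ^ 2)));
      auto using is_derive_psi, is_derive_Psi_l.
  - intros x Hx; apply Rlt_0_minus; unfold gam; apply tanhc_decr; split; [lra|].
    rewrite <- (sqrt_pow2 x) at 1 by lra; apply sqrt_lt_1; nra.
  - rewrite psi_0, Psi_0; ring.
Qed.

(** Since sqrt (x^2 + b^2) < x + b and [tanhc] decreases, the integral exceeds
    [psi (a + b) - psi b], and [psi b < b]. *)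
Lemma Psi_gt_psi a b : 0 < a -> 0 < b -> psi a - b < Psi a (b ^ 2).
Proof.
  intros Ha Hb; assert (Q : 0 < b ^ 2) by nra.
  assert (K : 0 < Psi a (b ^ 2) - (psi (a + b) - psi b)).
  { apply (increasing_from_0 (fun a => Psi a (b ^ 2) - (psi (a + b) - psi b))
             (fun a => gam (a ^ 2 + b ^ 2) - tanhc (a + b))); auto.
    - intros x; apply (is_derive_minus (fun a => Psi a (b ^ 2)) (fun a => psi (a + b) - psi b));
        [now apply is_derive_Psi_l|].
      evar_last.
      + apply (is_derive_minus (fun a => psi (a + b)) (fun a => psi b)).
        * apply (is_derive_comp psi (fun a => a + b)); [apply is_derive_psi|].
          auto_derive; [auto|reflexivity].
        * apply (is_derive_const (V := R_NormedModule)).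
      + unfold minus, plus, opp, scal, zero; simpl; unfold mult; simpl; ring.
    - intros x Hx; apply Rlt_0_minus; unfold gam; apply tanhc_decr; split; [apply sqrt_pos|].
      rewrite <- (sqrt_pow2 (x + b)) by lra; apply sqrt_lt_1; nra.
    - rewrite Psi_0, Rplus_0_l; ring. }
  generalize (psi_lt a (a + b) ltac:(lra)), (psi_lt_id b Hb); lra.
Qed.

(** * Estimates for log cosh *)

Lemma lcosh_0 : lcosh 0 = 0.
Proof. unfold lcosh; rewrite cosh_0; apply ln_1. Qed.

Lemma lcosh_le a b : 0 <= a <= b -> lcosh a <= lcosh b.
Proof.
  intros [Ha [Hab| ->]]; [|lra]; left; apply derive_pos_increasing with tanh; auto.
  - intros; eapply is_derive_continuity_pt, is_derive_lcosh.
  - intros; apply is_derive_lcosh.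
  - intros; apply tanh_pos; lra.
Qed.

Lemma lcosh_lip a b : a <= b -> lcosh b - lcosh a <= b - a.
Proof.
  intros [Hab| ->]; [|lra].
  enough (b - lcosh b > a - lcosh a) by lra.
  assert (D : forall x, is_derive (fun x => x - lcosh x) x (1 - tanh x)).
  { intros; apply (is_derive_minus (fun x => x) lcosh);
      [apply is_derive_Rid|apply is_derive_lcosh]. }
  apply (derive_pos_increasing (fun x => x - lcosh x) (fun x => 1 - tanh x)); auto.
  - intros; eapply is_derive_continuity_pt, D.
  - intros x _; generalize (tanh_bound x); lra.
Qed.

Lemma lcosh_gt z : z - ln 2 < lcosh z.
Proof.
  unfold lcosh; rewrite <- (ln_exp z) at 1; rewrite <- ln_div by (try apply exp_pos; lra).
  apply ln_increasing.
  - apply Rdiv_lt_0_compat; [apply exp_pos|lra].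
  - unfold cosh; generalize (exp_pos (- z)); lra.
Qed.

Lemma lcosh_le_id z : 0 <= z -> lcosh z <= z.
Proof. intros Hz; generalize (lcosh_lip 0 z Hz); rewrite lcosh_0; lra. Qed.

(** Makes [2 * T * lcosh (xm / (2 * T))] of order [1 / T], so that [gapG] becomes small at high
    temperature. *)
Lemma lcosh_lt_sqr z : 0 < z -> lcosh z < z ^ 2.
Proof.
  intros Hz; apply Rminus_lt_0.
  apply (increasing_from_0 (fun z => z ^ 2 - lcosh z) (fun z => 2 * z - tanh z)); auto.
  - intros x; apply (is_derive_minus (fun z => z ^ 2) lcosh); [|apply is_derive_lcosh].
    auto_derive; [auto|ring].
  - intros x Hx; generalize (tanh_lt x Hx); lra.
  - rewrite lcosh_0; ring.
Qed.

(** The derivative of [lcosh z - z * tanh z] is -z sech^2 z. At [z = r / 2T] the function is half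
    the [T]-derivative of [2 * T * lcosh (r / (2 * T))], and its decrease gives the sign of the
    non-integral terms of [gapH_T]. *)
Lemma lcosh_tanh_decr a b : 0 <= a <= b -> lcosh b - b * tanh b <= lcosh a - a * tanh a.
Proof.
  intros [Ha [Hab| ->]]; [|lra]; left.
  assert (D : forall x, is_derive (fun x => lcosh x - x * tanh x) x (- (x * (1 - tanh x ^ 2)))).
  { intros x; evar_last.
    - apply (is_derive_minus lcosh (fun x => x * tanh x)); [apply is_derive_lcosh|].
      apply (is_derive_mult (fun x => x) tanh);
        [apply is_derive_Rid|apply is_derive_tanh|intros; apply Rmult_comm].
    - unfold minus, plus, opp, mult, one; simpl; ring. }
  apply (derive_neg_decreasing (fun x => lcosh x - x * tanh x)
    (fun x => - (x * (1 - tanh x ^ 2)))); auto.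
  - intros; eapply is_derive_continuity_pt, D.
  - intros x Hx; generalize (tanh_bound x); intros.
    assert (0 < 1 - tanh x ^ 2) by nra. nra.
Qed.

(** * The gap functions *)

Definition rad (a T D : R) : R := sqrt (a ^ 2 + D ^ 2) / (2 * T).

Lemma hypot_ge a D : 0 <= a -> a <= sqrt (a ^ 2 + D ^ 2).
Proof. intros; rewrite <- (sqrt_pow2 a) at 1 by auto; apply sqrt_le_1; nra. Qed.

Lemma hypot_le a D : 0 <= a -> 0 <= D -> sqrt (a ^ 2 + D ^ 2) <= a + D.
Proof. intros; rewrite <- (sqrt_pow2 (a + D)) by lra; apply sqrt_le_1; nra. Qed.

Lemma hypot_pos a D : 0 < D -> 0 < sqrt (a ^ 2 + D ^ 2).
Proof. intros; apply sqrt_lt_R0; nra. Qed.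

Lemma hypot_le_l a b D : 0 <= a <= b -> sqrt (a ^ 2 + D ^ 2) <= sqrt (b ^ 2 + D ^ 2).
Proof. intros; apply sqrt_le_1; nra. Qed.

Lemma rad_pos a T D : 0 < T -> 0 < D -> 0 < rad a T D.
Proof. intros; apply Rdiv_lt_0_compat; [now apply hypot_pos|lra]. Qed.

Lemma rad_le a b T D : 0 < T -> 0 <= a <= b -> rad a T D <= rad b T D.
Proof.
  intros HT gapH; apply Rmult_le_compat_r; [|now apply hypot_le_l].
  left; apply Rinv_0_lt_compat; lra.
Qed.

Lemma rad_scale a T D : 0 < T -> sqrt ((a / (2 * T)) ^ 2 + (D / (2 * T)) ^ 2) = rad a T D.
Proof.
  intros HT; unfold rad.
  replace ((a / (2 * T)) ^ 2 + (D / (2 * T)) ^ 2) with ((a ^ 2 + D ^ 2) / (2 * T) ^ 2)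
    by (field; lra).
  rewrite sqrt_div by nra. now rewrite sqrt_pow2 by lra.
Qed.

Lemma gam_rad a T D : 0 < T -> gam ((a / (2 * T)) ^ 2 + (D / (2 * T)) ^ 2) = tanhc (rad a T D).
Proof. intros; unfold gam; now rewrite rad_scale. Qed.

Lemma is_derive_lcosh_rad a T D : 0 < T -> 0 < a ^ 2 + D ^ 2 ->
  is_derive (fun a => 2 * T * lcosh (rad a T D)) a (tanh (rad a T D) * (a / sqrt (a ^ 2 + D ^ 2))).
Proof.
  intros HT P; assert (S := sqrt_lt_R0 _ P); evar_last.
  - apply is_derive_scal, (is_derive_comp lcosh (fun a => rad a T D)); [apply is_derive_lcosh|].
    unfold rad; auto_derive; [exact P|reflexivity].
  - unfold scal; simpl in *; unfold mult; simpl; field; lra.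
Qed.

(** Energy and gap enter symmetrically, so the [D]-derivative of the log cosh terms is read off from
    the derivative in [a]. *)
Lemma rad_sym a T D : rad a T D = rad D T a.
Proof. unfold rad; now rewrite Rplus_comm. Qed.

Definition lct (z : R) : R := lcosh z - z * tanh z.

Lemma is_derive_lcosh_T r T : 0 < T ->
  is_derive (fun T => 2 * T * lcosh (r / (2 * T))) T (2 * lct (r / (2 * T))).
Proof.
  intros HT; evar_last.
  - apply (is_derive_mult (fun T => 2 * T) (fun T => lcosh (r / (2 * T))));
      [| |intros; apply Rmult_comm].
    + auto_derive; auto.
    + apply (is_derive_comp lcosh (fun T => r / (2 * T))); [apply is_derive_lcosh|].
      auto_derive; [lra|reflexivity].
  - unfold lct, plus, scal, mult; simpl; unfold mult; simpl; field; lra.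
Qed.

Section Gap.
Variable xm : R.
Hypothesis Hxm : 0 < xm.

(** The integral with weight max (xi, mu), split at [xi = mu]. On [[mu, xm]] the integrand xi tanh
    (r / 2T) / r has the primitive [2 * T * lcosh (r / (2 * T))]; on [[0, mu]] the substitution xi =
    2 T t produces [Psi]. *)
Definition gapH (mu T D : R) : R :=
  2 * T * lcosh (rad xm T D) - 2 * T * lcosh (rad mu T D)
  + mu * Psi (mu / (2 * T)) ((D / (2 * T)) ^ 2).

Definition gapH_D (mu T D : R) : R :=
  tanh (rad xm T D) * (D / sqrt (xm ^ 2 + D ^ 2))
  - tanh (rad mu T D) * (D / sqrt (mu ^ 2 + D ^ 2))
  + mu * (Psi' (mu / (2 * T)) ((D / (2 * T)) ^ 2) * (D / (2 * T ^ 2))).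

Definition gapH_mu (mu T D : R) : R := Psi (mu / (2 * T)) ((D / (2 * T)) ^ 2).

Definition gapH_T (mu T D : R) : R :=
  2 * lct (rad xm T D) - 2 * lct (rad mu T D)
  - mu / T * (mu / (2 * T) * gam ((mu / (2 * T)) ^ 2 + (D / (2 * T)) ^ 2)
              + 2 * (D / (2 * T)) ^ 2 * Psi' (mu / (2 * T)) ((D / (2 * T)) ^ 2)).

Lemma q_pos T D : 0 < T -> 0 < D -> 0 < (D / (2 * T)) ^ 2.
Proof. intros; apply pow_lt, Rdiv_lt_0_compat; lra. Qed.

Lemma is_derive_gapH_D mu T D : 0 < T -> 0 < D -> is_derive (gapH mu T) D (gapH_D mu T D).
Proof.
  intros HT HD; unfold gapH, gapH_D.
  assert (L : forall a, is_derive (fun D => 2 * T * lcosh (rad a T D)) D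
            (tanh (rad a T D) * (D / sqrt (a ^ 2 + D ^ 2)))).
  { intros a; apply is_derive_ext with (fun D => 2 * T * lcosh (rad D T a)).
    - intros; now rewrite (rad_sym a).
    - rewrite rad_sym, (Rplus_comm (a ^ 2)); apply is_derive_lcosh_rad; nra. }
  apply (is_derive_plus (fun D => 2 * T * lcosh (rad xm T D) - 2 * T * lcosh (rad mu T D))
    (fun D => mu * Psi (mu / (2 * T)) ((D / (2 * T)) ^ 2))).
  - apply (is_derive_minus (fun D => 2 * T * lcosh (rad xm T D))
      (fun D => 2 * T * lcosh (rad mu T D))); apply L.
  - apply is_derive_scal; evar_last.
    + apply (is_derive_comp (fun q => Psi (mu / (2 * T)) q) (fun D => (D / (2 * T)) ^ 2)).
      * now apply is_derive_Psi_r, q_pos.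
      * auto_derive; [lra|reflexivity].
    + unfold scal; simpl; unfold mult; simpl; field; lra.
Qed.

(** The boundary contributions at [xi = mu] from the log cosh term and from the upper limit of [Psi]
    cancel, which leaves the integral itself. *)
Lemma is_derive_gapH_mu mu T D : 0 < T -> 0 < D -> is_derive (fun mu => gapH mu T D) mu (gapH_mu mu T D).
Proof.
  intros HT HD; unfold gapH, gapH_mu; assert (S := hypot_pos mu D HD); evar_last.
  - apply (is_derive_plus (fun mu => 2 * T * lcosh (rad xm T D) - 2 * T * lcosh (rad mu T D))
      (fun mu => mu * Psi (mu / (2 * T)) ((D / (2 * T)) ^ 2))).
    + apply (is_derive_minus (fun mu => 2 * T * lcosh (rad xm T D))
        (fun mu => 2 * T * lcosh (rad mu T D))).
      * apply (is_derive_const (V := R_NormedModule)).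
      * apply is_derive_lcosh_rad; nra.
    + apply (is_derive_mult (fun mu => mu) (fun mu => Psi (mu / (2 * T)) ((D / (2 * T)) ^ 2)));
        [apply is_derive_Rid| |intros; apply Rmult_comm].
      apply (is_derive_comp (fun a => Psi a ((D / (2 * T)) ^ 2)) (fun mu => mu / (2 * T))).
      * now apply is_derive_Psi_l, q_pos.
      * auto_derive; [auto|reflexivity].
  - assert (P := rad_pos mu T D HT HD).
    rewrite gam_rad, tanhc_eq by lra.
    unfold plus, minus, opp, zero, plus, scal, mult; simpl; unfold mult; simpl.
    unfold rad at 3; simpl in *; field; lra.
Qed.

Lemma is_derive_gapH_T mu T D : 0 < T -> 0 < D -> is_derive (fun T => gapH mu T D) T (gapH_T mu T D).
Proof.
  intros HT HD; unfold gapH, gapH_T; evar_last.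
  - apply (is_derive_plus (fun T => 2 * T * lcosh (rad xm T D) - 2 * T * lcosh (rad mu T D))
      (fun T => mu * Psi (mu / (2 * T)) ((D / (2 * T)) ^ 2))).
    + apply (is_derive_minus (fun T => 2 * T * lcosh (rad xm T D))
        (fun T => 2 * T * lcosh (rad mu T D))); now apply is_derive_lcosh_T.
    + apply is_derive_scal, is_derive_Reals.
      (* [T] moves both arguments of [Psi], hence the use of its total differentiability. *)
      apply (derivable_pt_lim_comp_2d Psi (fun T => mu / (2 * T)) (fun T => (D / (2 * T)) ^ 2)).
      * now apply differentiable_Psi, q_pos.
      * apply is_derive_Reals; auto_derive; [lra|reflexivity].
      * apply is_derive_Reals; auto_derive; [lra|reflexivity].
  - unfold plus, minus, opp, plus; simpl; unfold rad; simpl; field; lra.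
Qed.

Lemma lct_decr a b : 0 <= a <= b -> lct b <= lct a.
Proof. apply lcosh_tanh_decr. Qed.

Lemma gapH_mu_pos mu T D : 0 < mu -> 0 < T -> 0 < D -> 0 < gapH_mu mu T D.
Proof. intros; apply Psi_pos; [apply Rdiv_lt_0_compat; lra|now apply q_pos]. Qed.

(** The [lct] difference is at most 0 because the radius at [xm] is at least that at [mu]; it
    vanishes at [mu = xm], and strictness comes from [Psi_scaling_pos]. *)
Lemma gapH_T_neg mu T D : 0 < mu <= xm -> 0 < T -> 0 < D -> gapH_T mu T D < 0.
Proof.
  intros Hm HT HD; unfold gapH_T.
  assert (L : lct (rad xm T D) <= lct (rad mu T D)).
  { apply lct_decr; split; [left; now apply rad_pos|apply rad_le; lra]. }
  assert (a0 : 0 < mu / (2 * T)) by (apply Rdiv_lt_0_compat; lra).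
  assert (P := Psi_scaling_pos _ _ a0 (q_pos T D HT HD)).
  assert (0 < mu / T) by (apply Rdiv_lt_0_compat; lra).
  nra.
Qed.

Lemma tanh_rad a T D : 0 < T -> 0 < D ->
  tanh (rad a T D) * (D / sqrt (a ^ 2 + D ^ 2)) = D / (2 * T) * tanhc (rad a T D).
Proof.
  intros HT HD; assert (P := rad_pos a T D HT HD); assert (S := hypot_pos a D HD).
  rewrite tanhc_eq by lra; unfold rad at 3; field; lra.
Qed.

(** Rewritten through [tanhc], the first two terms differ by a quantity that is at most 0 and
    vanishes at [mu = xm]; [Psi' < 0] supplies strictness. *)
Lemma gapH_D_neg mu T D : 0 < mu <= xm -> 0 < T -> 0 < D -> gapH_D mu T D < 0.
Proof.
  intros Hm HT HD; unfold gapH_D; rewrite !tanh_rad by auto.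
  assert (a0 : 0 < mu / (2 * T)) by (apply Rdiv_lt_0_compat; lra).
  assert (d0 : 0 < D / (2 * T)) by (apply Rdiv_lt_0_compat; lra).
  assert (e0 : 0 < D / (2 * T ^ 2)) by (apply Rdiv_lt_0_compat; nra).
  assert (P := Psi'_neg _ _ a0 (q_pos T D HT HD)).
  assert (L : tanhc (rad xm T D) <= tanhc (rad mu T D)).
  { assert (K := rad_le mu xm T D HT ltac:(lra)).
    destruct (Req_dec (rad mu T D) (rad xm T D)) as [E|E]; [rewrite E; lra|].
    left; apply tanhc_decr; generalize (rad_pos mu T D HT HD); lra. }
  assert (mu * (- Psi' (mu / (2 * T)) ((D / (2 * T)) ^ 2) * (D / (2 * T ^ 2))) > 0).
  { apply Rmult_lt_0_compat; [lra|]. apply Rmult_lt_0_compat; lra. }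
  nra.
Qed.

Lemma gapH_decr_D mu T D E : 0 < mu <= xm -> 0 < T -> 0 < D < E -> gapH mu T E < gapH mu T D.
Proof.
  intros; apply derive_neg_decreasing with (gapH_D mu T); try lra.
  - intros; eapply is_derive_continuity_pt, is_derive_gapH_D; lra.
  - intros; apply is_derive_gapH_D; lra.
  - intros; apply gapH_D_neg; lra.
Qed.

(** * Smoothness of the gap function along smooth arguments *)

Section Ck_gapH.
Variables (n : nat) (U : (nat -> R) -> Prop) (k : nat) (m t d : (nat -> R) -> R).
Hypothesis Ut : forall x, U x -> 0 < t x.
Hypothesis Ud : forall x, U x -> 0 < d x.
Hypothesis Cm : Ck n k U m.
Hypothesis Ct : Ck n k U t.
Hypothesis Cd : Ck n k U d.

Lemma Ck_2t : Ck n k U (fun x => 2 * t x).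
Proof. apply Ck_mult; auto using Ck_const. Qed.

Lemma Ck_over_2t f : Ck n k U f -> Ck n k U (fun x => f x / (2 * t x)).
Proof. intros; apply Ck_div; auto using Ck_2t; intros x Ux; generalize (Ut x Ux); lra. Qed.

Lemma Ck_hypot f : Ck n k U f -> Ck n k U (fun x => sqrt (f x ^ 2 + d x ^ 2)).
Proof.
  intros; apply Ck_sqrt; auto using Ck_plus, Ck_pow.
  intros x Ux; generalize (Ud x Ux); nra.
Qed.

Lemma Ck_rad f : Ck n k U f -> Ck n k U (fun x => rad (f x) (t x) (d x)).
Proof. intros; unfold rad; auto using Ck_over_2t, Ck_hypot. Qed.

Lemma Ck_q : Ck n k U (fun x => (d x / (2 * t x)) ^ 2).
Proof. auto using Ck_pow, Ck_over_2t. Qed.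

Lemma Ck_Psi : Ck n k U (fun x => Psi (m x / (2 * t x)) ((d x / (2 * t x)) ^ 2)).
Proof.
  apply Ck_prim; auto using gamn_derive, Ck_q, Ck_over_2t; intros; apply q_pos; auto.
Qed.

Lemma Ck_Psi' : Ck n k U (fun x => Psi' (m x / (2 * t x)) ((d x / (2 * t x)) ^ 2)).
Proof.
  apply Ck_prim; auto using gamn_derive, Ck_q, Ck_over_2t; intros; apply q_pos; auto.
Qed.

Lemma Ck_gapH : Ck n k U (fun x => gapH (m x) (t x) (d x)).
Proof.
  unfold gapH; apply Ck_plus; [apply Ck_minus; apply Ck_mult|];
    auto using Ck_2t, Ck_lcosh, Ck_rad, Ck_const, Ck_mult, Ck_Psi.
Qed.

(** The function [d] is arbitrary because it plays two parts: the spare coordinate, for joint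
    continuity, and the solution itself, for the bootstrap. *)
Lemma Ck_gapH_D : Ck n k U (fun x => gapH_D (m x) (t x) (d x)).
Proof.
  assert (S : forall f, Ck n k U f -> Ck n k U (fun x => d x / sqrt (f x ^ 2 + d x ^ 2))).
  { intros f Hf; apply Ck_div; auto using Ck_hypot.
    intros x Ux; generalize (hypot_pos (f x) _ (Ud x Ux)); lra. }
  unfold gapH_D; apply Ck_plus; [apply Ck_minus; apply Ck_mult|apply Ck_mult; auto; apply Ck_mult];
    auto using Ck_tanh, Ck_rad, Ck_const, Ck_Psi'.
  apply Ck_div; auto using Ck_mult, Ck_pow, Ck_const.
  intros x Ux; generalize (Ut x Ux); nra.
Qed.

Lemma Ck_lct f : Ck n k U f -> Ck n k U (fun x => lct (f x)).
Proof. intros; unfold lct; auto using Ck_minus, Ck_mult, Ck_lcosh, Ck_tanh. Qed.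

Lemma Ck_gapH_T : Ck n k U (fun x => gapH_T (m x) (t x) (d x)).
Proof.
  unfold gapH_T; apply Ck_minus; [apply Ck_minus; apply Ck_mult|apply Ck_mult; [|apply Ck_plus]];
    auto using Ck_lct, Ck_rad, Ck_const.
  - apply Ck_div; auto; intros x Ux; generalize (Ut x Ux); lra.
  - apply Ck_mult; [now apply Ck_over_2t|].
    apply (Ck_family gamn gamn_derive) with (j := 0%nat)
      (f := fun x => (m x / (2 * t x)) ^ 2 + (d x / (2 * t x)) ^ 2).
    + intros x Ux; generalize (q_pos _ _ (Ut x Ux) (Ud x Ux)); nra.
    + auto using Ck_plus, Ck_pow, Ck_over_2t.
  - apply Ck_mult; [apply Ck_mult|]; auto using Ck_const, Ck_q, Ck_Psi'.
Qed.
End Ck_gapH.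

(** * The limit of vanishing gap, which determines the critical temperature *)

Definition gapG (mu T : R) : R :=
  2 * T * lcosh (xm / (2 * T)) - 2 * T * lcosh (mu / (2 * T)) + mu * psi (mu / (2 * T)).

Definition gapG_mu (mu T : R) : R := psi (mu / (2 * T)).

Definition gapG_T (mu T : R) : R :=
  2 * lct (xm / (2 * T)) - 2 * lct (mu / (2 * T)) - mu / T * tanh (mu / (2 * T)).

Lemma is_derive_gapG_T mu T : 0 < mu -> 0 < T -> is_derive (gapG mu) T (gapG_T mu T).
Proof.
  intros Hm HT; unfold gapG, gapG_T; evar_last.
  - apply (is_derive_plus (fun T => 2 * T * lcosh (xm / (2 * T)) - 2 * T * lcosh (mu / (2 * T)))
      (fun T => mu * psi (mu / (2 * T)))).
    + apply (is_derive_minus (fun T => 2 * T * lcosh (xm / (2 * T)))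
        (fun T => 2 * T * lcosh (mu / (2 * T)))); now apply is_derive_lcosh_T.
    + apply is_derive_scal, (is_derive_comp psi (fun T => mu / (2 * T))).
      * apply is_derive_psi.
      * auto_derive; [lra|reflexivity].
  - assert (0 < mu / (2 * T)) by (apply Rdiv_lt_0_compat; lra).
    rewrite tanhc_eq by lra.
    unfold plus, minus, opp, plus, scal; simpl; unfold mult; simpl; field; lra.
Qed.

Lemma is_derive_gapG_mu mu T : 0 < mu -> 0 < T -> is_derive (fun mu => gapG mu T) mu (gapG_mu mu T).
Proof.
  intros Hm HT; unfold gapG, gapG_mu; evar_last.
  - apply (is_derive_plus (fun mu => 2 * T * lcosh (xm / (2 * T)) - 2 * T * lcosh (mu / (2 * T)))
      (fun mu => mu * psi (mu / (2 * T)))).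
    + apply (is_derive_minus (fun mu => 2 * T * lcosh (xm / (2 * T)))
        (fun mu => 2 * T * lcosh (mu / (2 * T)))).
      * apply (is_derive_const (V := R_NormedModule)).
      * apply is_derive_scal, (is_derive_comp lcosh (fun mu => mu / (2 * T)));
          [apply is_derive_lcosh|]. auto_derive; [auto|reflexivity].
    + apply (is_derive_mult (fun mu => mu) (fun mu => psi (mu / (2 * T))));
        [apply is_derive_Rid| |intros; apply Rmult_comm].
      apply (is_derive_comp psi (fun mu => mu / (2 * T))); [apply is_derive_psi|].
      auto_derive; [auto|reflexivity].
  - assert (0 < mu / (2 * T)) by (apply Rdiv_lt_0_compat; lra).
    rewrite tanhc_eq by lra.
    unfold plus, minus, opp, zero, plus, scal, mult; simpl; unfold mult; simpl; field; lra.
Qed.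

Lemma gapG_T_neg mu T : 0 < mu <= xm -> 0 < T -> gapG_T mu T < 0.
Proof.
  intros Hm HT; unfold gapG_T.
  assert (a0 : 0 < mu / (2 * T)) by (apply Rdiv_lt_0_compat; lra).
  assert (L : lct (xm / (2 * T)) <= lct (mu / (2 * T))).
  { apply lct_decr; split; [lra|]. apply Rmult_le_compat_r; [|lra].
    left; apply Rinv_0_lt_compat; lra. }
  assert (0 < mu / T) by (apply Rdiv_lt_0_compat; lra).
  generalize (tanh_pos _ a0); nra.
Qed.

Lemma gapG_mu_pos mu T : 0 < mu -> 0 < T -> 0 < gapG_mu mu T.
Proof. intros; apply psi_pos, Rdiv_lt_0_compat; lra. Qed.

Lemma gapG_decr mu T T' : 0 < mu <= xm -> 0 < T < T' -> gapG mu T' < gapG mu T.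
Proof.
  intros; apply derive_neg_decreasing with (gapG_T mu); try lra.
  - intros; eapply is_derive_continuity_pt, is_derive_gapG_T; lra.
  - intros; apply is_derive_gapG_T; lra.
  - intros; apply gapG_T_neg; lra.
Qed.

(** Positivity of [f] keeps the argument away from 0, so the derivative [tanhc] may be replaced by
    the quotient [tanh (f x) / f x]. *)
Lemma Ck_psi n U k f : (forall x, U x -> 0 < f x) -> Ck n k U f ->
  Ck n k U (fun x => psi (f x)).
Proof.
  intros Hf; revert k; apply Ck_comp1 with tanhc.
  - intros; apply is_derive_psi.
  - intros k Cf _; apply Ck_ext with (fun x => tanh (f x) / f x).
    + intros x Ux; rewrite tanhc_eq; auto; generalize (Hf x Ux); lra.
    + apply Ck_div; auto using Ck_tanh. intros x Ux; generalize (Hf x Ux); lra.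
Qed.

Section Ck_gapG.
Variables (n : nat) (U : (nat -> R) -> Prop) (k : nat) (m t : (nat -> R) -> R).
Hypothesis Um : forall x, U x -> 0 < m x.
Hypothesis Ut : forall x, U x -> 0 < t x.
Hypothesis Cm : Ck n k U m.
Hypothesis Ct : Ck n k U t.

Lemma Ck_gapG_mu : Ck n k U (fun x => gapG_mu (m x) (t x)).
Proof.
  unfold gapG_mu; apply Ck_psi with (f := fun x => m x / (2 * t x)); auto using Ck_over_2t.
  intros x Ux; generalize (Um x Ux), (Ut x Ux); intros; apply Rdiv_lt_0_compat; lra.
Qed.

Lemma Ck_gapG : Ck n k U (fun x => gapG (m x) (t x)).
Proof.
  unfold gapG; apply Ck_plus; [apply Ck_minus; apply Ck_mult|apply Ck_mult; auto; apply Ck_gapG_mu];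
    auto using Ck_2t, Ck_lcosh, Ck_over_2t, Ck_const.
Qed.

Lemma Ck_gapG_T : Ck n k U (fun x => gapG_T (m x) (t x)).
Proof.
  unfold gapG_T; apply Ck_minus; [apply Ck_minus; apply Ck_mult|apply Ck_mult];
    auto using Ck_lct, Ck_over_2t, Ck_const, Ck_tanh.
  apply Ck_div; auto; intros x Ux; generalize (Ut x Ux); lra.
Qed.
End Ck_gapG.

(** * The zero-temperature limit *)

Definition gapZ (mu D : R) : R :=
  sqrt (xm ^ 2 + D ^ 2) - sqrt (mu ^ 2 + D ^ 2) + mu * ln ((mu + sqrt (mu ^ 2 + D ^ 2)) / D).

Definition gapZ_D (mu D : R) : R :=
  D / sqrt (xm ^ 2 + D ^ 2) - D / sqrt (mu ^ 2 + D ^ 2) - mu ^ 2 / (D * sqrt (mu ^ 2 + D ^ 2)).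

Definition gapZ_mu (mu D : R) : R := ln ((mu + sqrt (mu ^ 2 + D ^ 2)) / D).

Lemma is_derive_gapZ_D mu D : 0 < mu -> 0 < D -> is_derive (gapZ mu) D (gapZ_D mu D).
Proof.
  intros Hm HD; unfold gapZ, gapZ_D.
  assert (S := hypot_pos mu D HD); assert (S' := hypot_pos xm D HD).
  assert (E := sqrt_def (mu ^ 2 + D ^ 2) ltac:(nra)).
  simpl in *; auto_derive; simpl.
  - repeat split; try nra. apply Rdiv_lt_0_compat; lra.
  - set (s := sqrt (mu * (mu * 1) + D * (D * 1))) in *.
    set (s' := sqrt (xm * (xm * 1) + D * (D * 1))) in *.
    (* Turns [D * D - s * (mu + s)] into [- mu * (mu + s)], which cancels the denominator [mu + s]
       coming from the logarithm. *)
    assert (E2 : D * D = s * s - mu * mu) by lra.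
    transitivity (D / s' - D / s + mu * (D / s * / (mu + s) - / D)); [field; repeat split; lra|].
    replace (mu * (D / s * / (mu + s) - / D)) with (mu * (D * D - s * (mu + s)) / (D * s * (mu + s)))
      by (field; repeat split; lra).
    rewrite E2; field; repeat split; lra.
Qed.

Lemma is_derive_gapZ_mu mu D : 0 < D -> is_derive (fun mu => gapZ mu D) mu (gapZ_mu mu D).
Proof.
  intros HD; unfold gapZ, gapZ_mu; assert (S := hypot_pos mu D HD); evar_last.
  - apply (is_derive_plus (fun mu => sqrt (xm ^ 2 + D ^ 2) - sqrt (mu ^ 2 + D ^ 2))
      (fun mu => mu * ln ((mu + sqrt (mu ^ 2 + D ^ 2)) / D))).
    + assert (P : 0 < mu ^ 2 + D ^ 2) by nra.
      auto_derive; [exact P|reflexivity].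
    + apply (is_derive_mult (fun mu => mu) (fun mu => ln ((mu + sqrt (mu ^ 2 + D ^ 2)) / D)));
        [apply is_derive_Rid|now apply is_derive_asinh_l|intros; apply Rmult_comm].
  - unfold plus, mult; simpl in *; field; lra.
Qed.

Lemma gapZ_mu_pos mu D : 0 < mu -> 0 < D -> 0 < gapZ_mu mu D.
Proof.
  intros Hm HD; unfold gapZ_mu; rewrite <- ln_1; apply ln_increasing; [lra|].
  apply Rmult_lt_reg_r with D; auto. unfold Rdiv; rewrite Rmult_assoc, Rinv_l by lra.
  generalize (hypot_ge D mu ltac:(lra)); rewrite Rplus_comm; lra.
Qed.

Lemma gapZ_D_neg mu D : 0 < mu <= xm -> 0 < D -> gapZ_D mu D < 0.
Proof.
  intros Hm HD; unfold gapZ_D.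
  assert (S := hypot_pos mu D HD).
  assert (L := hypot_le_l mu xm D ltac:(lra)).
  assert (/ sqrt (xm ^ 2 + D ^ 2) <= / sqrt (mu ^ 2 + D ^ 2)) by now apply Rinv_le_contravar.
  assert (0 < mu ^ 2 / (D * sqrt (mu ^ 2 + D ^ 2))) by (apply Rdiv_lt_0_compat; nra).
  unfold Rdiv at 1 2; nra.
Qed.

Lemma gapZ_decr mu D E : 0 < mu <= xm -> 0 < D < E -> gapZ mu E < gapZ mu D.
Proof.
  intros; apply derive_neg_decreasing with (gapZ_D mu); try lra.
  - intros; eapply is_derive_continuity_pt, is_derive_gapZ_D; lra.
  - intros; apply is_derive_gapZ_D; lra.
  - intros; apply gapZ_D_neg; lra.
Qed.

Lemma gapZ_incr_mu mu mu' D : 0 <= mu < mu' -> 0 < D -> gapZ mu D < gapZ mu' D.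
Proof.
  intros; apply (derive_pos_increasing (fun mu => gapZ mu D) (fun mu => gapZ_mu mu D)); try lra.
  - intros; eapply is_derive_continuity_pt, is_derive_gapZ_mu; lra.
  - intros; apply is_derive_gapZ_mu; lra.
  - intros; apply gapZ_mu_pos; lra.
Qed.

Section Ck_gapZ.
Variables (n : nat) (U : (nat -> R) -> Prop) (k : nat) (m d : (nat -> R) -> R).
Hypothesis Um : forall x, U x -> 0 < m x.
Hypothesis Ud : forall x, U x -> 0 < d x.
Hypothesis Cm : Ck n k U m.
Hypothesis Cd : Ck n k U d.

Lemma Ck_gapZ_mu : Ck n k U (fun x => gapZ_mu (m x) (d x)).
Proof.
  unfold gapZ_mu; apply Ck_ln.
  - intros x Ux; generalize (Um x Ux), (Ud x Ux), (hypot_pos (m x) _ (Ud x Ux)); intros.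
    apply Rdiv_lt_0_compat; lra.
  - apply Ck_div; auto using Ck_plus, Ck_hypot. intros x Ux; generalize (Ud x Ux); lra.
Qed.

Lemma Ck_gapZ : Ck n k U (fun x => gapZ (m x) (d x)).
Proof.
  unfold gapZ; apply Ck_plus; [apply Ck_minus|apply Ck_mult; auto; apply Ck_gapZ_mu].
  - apply (Ck_hypot n U k d Ud Cd (fun _ => xm)), Ck_const.
  - now apply Ck_hypot.
Qed.

Lemma Ck_gapZ_D : Ck n k U (fun x => gapZ_D (m x) (d x)).
Proof.
  assert (S : forall f, Ck n k U f -> Ck n k U (fun x => d x / sqrt (f x ^ 2 + d x ^ 2))).
  { intros f Hf; apply Ck_div; auto using Ck_hypot.
    intros x Ux; generalize (hypot_pos (f x) _ (Ud x Ux)); lra. }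
  unfold gapZ_D; apply Ck_minus; [apply Ck_minus|]; auto.
  - apply (S (fun _ => xm)), Ck_const.
  - apply Ck_div; auto using Ck_pow, Ck_mult, Ck_hypot.
    intros x Ux; generalize (Ud x Ux), (hypot_pos (m x) _ (Ud x Ux)); nra.
Qed.
End Ck_gapZ.

End Gap.

(** * Solutions *)

(** Bridge between the two integrals: integrability excludes the default branch, and the chosen
    integrability proof does not affect the value. *)
Lemma Defs_RInt_eq (f : R -> R) a b l : is_RInt f a b l -> Defs.RInt f a b = l.
Proof.
  intros Hf; unfold Defs.RInt.
  destruct (excluded_middle_informative _) as [J|J].
  - rewrite <- RInt_Reals; now apply is_RInt_unique.
  - exfalso; apply J; constructor; apply ex_RInt_Reals_0; now exists l.
Qed.

(** The substitution is carried out by exhibiting the primitive [D * Psi (x / (2 * T)) q] of the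
    integrand. *)
Lemma gap_integral mu T D : 0 < mu -> 0 < T -> 0 < D ->
  Defs.RInt (fun xi => tanh (sqrt (xi ^ 2 + D ^ 2) / (2 * T)) * D / sqrt (xi ^ 2 + D ^ 2)) 0 mu
  = D * Psi (mu / (2 * T)) ((D / (2 * T)) ^ 2).
Proof.
  intros Hm HT HD; assert (Q := q_pos T D HT HD); apply Defs_RInt_eq.
  set (q := (D / (2 * T)) ^ 2) in *.
  set (F := fun x => D * Psi (x / (2 * T)) q).
  set (f := fun x => D / (2 * T) * gam ((x / (2 * T)) ^ 2 + q)).
  assert (E : forall x, tanh (sqrt (x ^ 2 + D ^ 2) / (2 * T)) * D / sqrt (x ^ 2 + D ^ 2) = f x).
  { intros x; unfold f, q; rewrite gam_rad, <- tanh_rad by auto.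
    unfold rad, Rdiv; ring. }
  assert (P : D * Psi (mu / (2 * T)) q = minus (F mu) (F 0)).
  { unfold F, minus, plus, opp; simpl.
    replace (0 / (2 * T)) with 0 by (field; lra). rewrite Psi_0; ring. }
  rewrite P; apply is_RInt_ext with f; [now intros; symmetry|].
  apply (is_RInt_derive F f).
  - intros x _; unfold F, f; evar_last.
    + apply is_derive_scal, (is_derive_comp (fun a => Psi a q) (fun x => x / (2 * T))).
      * now apply is_derive_Psi_l.
      * auto_derive; [auto|reflexivity].
    + unfold scal; simpl; unfold mult; simpl; field; lra.
  - intros x _; apply (ex_derive_continuous (V := R_NormedModule)); unfold f.
    apply ex_derive_scal, (ex_derive_comp gam (fun x => (x / (2 * T)) ^ 2 + q)).
    + eexists; apply is_derive_gam; nra.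
    + auto_derive; auto.
Qed.

Lemma Tc_integral mu T : 0 < mu -> 0 < T ->
  Defs.RInt (fun xi => / xi * tanh (xi / (2 * T))) 0 mu = psi (mu / (2 * T)).
Proof.
  intros Hm HT; apply Defs_RInt_eq.
  set (F := fun x => psi (x / (2 * T))).
  set (f := fun x => / (2 * T) * tanhc (x / (2 * T))).
  assert (P : psi (mu / (2 * T)) = minus (F mu) (F 0)).
  { unfold F, minus, plus, opp; simpl.
    replace (0 / (2 * T)) with 0 by (field; lra). rewrite psi_0; ring. }
  rewrite P; apply is_RInt_ext with f.
  (* Only interior points are compared. At 0 the two integrands differ: one is [/ 0 * 0], the other
     its continuous extension [/ (2 * T)]. *)
  { intros x Hx; rewrite Rmin_left, Rmax_right in Hx by lra.
    assert (0 < x / (2 * T)) by (apply Rdiv_lt_0_compat; lra).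
    unfold f; rewrite tanhc_eq by lra.
    match goal with |- @eq _ ?a ?b => change (@eq R a b) end; field; lra. }
  apply (is_RInt_derive F f).
  - intros x _; unfold F, f; evar_last.
    + apply (is_derive_comp psi (fun x => x / (2 * T))); [apply is_derive_psi|].
      auto_derive; [auto|reflexivity].
    + unfold scal; simpl; unfold mult; simpl; ring.
  - intros x _; apply (continuous_scal_r (V := R_NormedModule) (/ (2 * T))
      (fun x => tanhc (x / (2 * T)))).
    apply (continuous_comp (fun x => x / (2 * T)) tanhc).
    + apply (ex_derive_continuous (V := R_NormedModule)); auto_derive; auto.
    + apply continuity_pt_filterlim, tanhc_continuity.
Qed.

Lemma ln_cosh_div a b : ln (cosh a / cosh b) = lcosh a - lcosh b.
Proof. apply ln_div; apply cosh_pos. Qed.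

Lemma gapR_iff xm mu T lam D : 0 < mu -> 0 < T -> 0 < D ->
  gapR xm mu T lam D <-> gapH xm mu T D = xm / lam.
Proof.
  intros Hm HT HD; unfold gapR, gapH; rewrite gap_integral, ln_cosh_div by auto.
  fold (rad xm T D) (rad mu T D).
  split; intros E.
  - apply Rmult_eq_reg_r with D; lra.
  - rewrite <- E; ring.
Qed.

Lemma TcEq_iff xm mu lam T : 0 < mu -> 0 < T -> TcEq xm mu lam T <-> gapG xm mu T = xm / lam.
Proof.
  intros Hm HT; unfold TcEq, gapG; rewrite Tc_integral, ln_cosh_div by auto; lra.
Qed.

(** The order of [a] and [b] follows from monotonicity, so it suffices to exhibit one point where
    [f] exceeds [c] and one where it stays below. *)
Lemma decreasing_IVT (f df : R -> R) c a b :
  (forall x, 0 < x -> is_derive f x (df x)) ->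
  (forall x y, 0 < x < y -> f y < f x) ->
  0 < a -> 0 < b -> c < f a -> f b < c -> exists z, a < z < b /\ f z = c.
Proof.
  intros D M Ha Hb Ca Cb.
  assert (ab : a < b).
  { destruct (Rtotal_order a b) as [L|[->|L]]; auto; [lra|].
    specialize (M b a ltac:(lra)); lra. }
  destruct (Ranalysis5.IVT_interv (fun x => c - f x) a b) as [z [Hz E]]; try lra.
  - intros x Hx; apply continuity_pt_minus; [now apply continuity_pt_const|].
    eapply is_derive_continuity_pt, D; lra.
  - exists z; split; [|lra].
    split; apply Rnot_le_lt; intros L;
      [assert (z = a) by lra|assert (z = b) by lra]; subst; lra.
Qed.

Section Solutions.
Variable xm : R.
Hypothesis Hxm : 0 < xm.
Local Notation gapH := (gapH xm).
Local Notation gapG := (gapG xm).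
Local Notation gapZ := (gapZ xm).

(** * Comparison of the gap function with its two limits *)

Lemma gapH_lt_G_plus mu T D : 0 < mu <= xm -> 0 < T -> 0 < D -> gapH mu T D < gapG mu T + D.
Proof.
  intros Hm HT HD; unfold gapH, gapG.
  assert (i0 : 0 < / (2 * T)) by (apply Rinv_0_lt_compat; lra).
  assert (B1 : xm / (2 * T) <= rad xm T D).
  { apply Rmult_le_compat_r; [lra|]; apply hypot_ge; lra. }
  assert (B2 : mu / (2 * T) <= rad mu T D).
  { apply Rmult_le_compat_r; [lra|]; apply hypot_ge; lra. }
  assert (B3 : rad xm T D <= xm / (2 * T) + D / (2 * T)).
  { unfold Rdiv; rewrite <- Rmult_plus_distr_r.
    apply Rmult_le_compat_r; [lra|]; apply hypot_le; lra. }
  assert (a0 : 0 < mu / (2 * T)) by (apply Rdiv_lt_0_compat; lra).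
  assert (d0 : 0 < D / (2 * T)) by (apply Rdiv_lt_0_compat; lra).
  assert (L1 := lcosh_lip _ _ B1).
  assert (L2 := lcosh_le _ _ (conj (Rlt_le _ _ a0) B2)).
  assert (P := Psi_lt_psi _ _ a0 d0).
  assert (M1 : 2 * T * lcosh (rad xm T D) <= 2 * T * (lcosh (xm / (2 * T)) + D / (2 * T)))
    by (apply Rmult_le_compat_l; lra).
  assert (M2 : 2 * T * lcosh (mu / (2 * T)) <= 2 * T * lcosh (rad mu T D))
    by (apply Rmult_le_compat_l; lra).
  assert (M3 := Rmult_lt_compat_l mu _ _ ltac:(lra) P).
  replace (2 * T * (lcosh (xm / (2 * T)) + D / (2 * T)))
    with (2 * T * lcosh (xm / (2 * T)) + D) in M1 by (field; lra).
  lra.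
Qed.

(** As [lcosh] is 1-Lipschitz on increasing pairs and the radius at [mu] is at most
    [(mu + D) / (2 * T)], the log cosh terms lose at most [D]. The bound [Psi_gt_psi], multiplied by
    [mu], accounts for the loss [mu * D / (2 * T)]. *)
Lemma gapH_gt_G_minus mu T D : 0 < mu <= xm -> 0 < T -> 0 < D ->
  gapG mu T - D * (1 + mu / (2 * T)) < gapH mu T D.
Proof.
  intros Hm HT HD; unfold gapH, gapG.
  assert (i0 : 0 < / (2 * T)) by (apply Rinv_0_lt_compat; lra).
  assert (B1 : xm / (2 * T) <= rad xm T D).
  { apply Rmult_le_compat_r; [lra|]; apply hypot_ge; lra. }
  assert (B2 : mu / (2 * T) <= rad mu T D).
  { apply Rmult_le_compat_r; [lra|]; apply hypot_ge; lra. }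
  assert (B3 : rad mu T D <= mu / (2 * T) + D / (2 * T)).
  { unfold Rdiv; rewrite <- Rmult_plus_distr_r.
    apply Rmult_le_compat_r; [lra|]; apply hypot_le; lra. }
  assert (a0 : 0 < mu / (2 * T)) by (apply Rdiv_lt_0_compat; lra).
  assert (x0 : 0 < xm / (2 * T)) by (apply Rdiv_lt_0_compat; lra).
  assert (d0 : 0 < D / (2 * T)) by (apply Rdiv_lt_0_compat; lra).
  assert (L1 := lcosh_lip _ _ B2).
  assert (L2 := lcosh_le _ _ (conj (Rlt_le _ _ x0) B1)).
  assert (P := Psi_gt_psi _ _ a0 d0).
  assert (M1 : 2 * T * lcosh (rad mu T D) <= 2 * T * (lcosh (mu / (2 * T)) + D / (2 * T)))
    by (apply Rmult_le_compat_l; lra).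
  assert (M2 : 2 * T * lcosh (xm / (2 * T)) <= 2 * T * lcosh (rad xm T D))
    by (apply Rmult_le_compat_l; lra).
  assert (M3 := Rmult_lt_compat_l mu _ _ ltac:(lra) P).
  replace (2 * T * (lcosh (mu / (2 * T)) + D / (2 * T)))
    with (2 * T * lcosh (mu / (2 * T)) + D) in M1 by (field; lra).
  replace (D * (1 + mu / (2 * T))) with (D + mu * (D / (2 * T))) by (field; lra).
  lra.
Qed.

(** The additive error [D] of the crude bound is removed by monotonicity: an excess of [gapH] over
    [gapG] at one gap would persist at every smaller gap [e], where it must stay below [e]. *)
Lemma gapH_lt_G mu T D : 0 < mu <= xm -> 0 < T -> 0 < D -> gapH mu T D < gapG mu T.
Proof.
  intros Hm HT HD.
  (* Strictness is spent on the step from [D] to [D / 2]; a weak inequality at [D / 2] remains. *)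
  apply Rlt_le_trans with (gapH mu T (D / 2)); [apply gapH_decr_D; lra|].
  apply Rnot_lt_le; intros C.
  set (e := Rmin (D / 4) (gapH mu T (D / 2) - gapG mu T)).
  assert (E : 0 < e) by (apply Rmin_pos; lra).
  assert (E1 : e <= D / 4) by apply Rmin_l.
  assert (E2 : e <= gapH mu T (D / 2) - gapG mu T) by apply Rmin_r.
  assert (K := gapH_lt_G_plus mu T e Hm HT E).
  assert (K' := gapH_decr_D xm mu T e (D / 2) Hm HT ltac:(lra)).
  lra.
Qed.

Lemma asinh_scale mu T D : 0 < T -> 0 < D ->
  (mu / (2 * T) + sqrt ((mu / (2 * T)) ^ 2 + (D / (2 * T)) ^ 2)) / (D / (2 * T))
  = (mu + sqrt (mu ^ 2 + D ^ 2)) / D.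
Proof. intros HT HD; rewrite rad_scale by auto; unfold rad; simpl; field; lra. Qed.

Lemma gapH_lt_Z mu T D : 0 < mu <= xm -> 0 < T -> 0 < D -> gapH mu T D < gapZ mu D.
Proof.
  intros Hm HT HD; unfold gapH, gapZ.
  assert (a0 : 0 < mu / (2 * T)) by (apply Rdiv_lt_0_compat; lra).
  assert (d0 : 0 < D / (2 * T)) by (apply Rdiv_lt_0_compat; lra).
  assert (P := Psi_lt_asinh _ _ a0 d0); rewrite asinh_scale in P by auto.
  assert (L := lcosh_lip _ _ (rad_le mu xm T D HT ltac:(lra))).
  assert (E : forall a, sqrt (a ^ 2 + D ^ 2) = 2 * T * rad a T D)
    by (intros; unfold rad; field; lra).
  rewrite (E xm), (E mu) at 1; nra.
Qed.

(** The term with [ln 2] comes from cosh z > exp z / 2 at the radius of [xm], the other one from the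
    error [a / b ^ 2] in [Psi_gt_asinh]. Both vanish linearly in [T]. *)
Lemma gapH_gt_Z_minus mu T D : 0 < mu <= xm -> 0 < T -> 0 < D ->
  gapZ mu D - T * (2 * ln 2 + 2 * mu ^ 2 / D ^ 2) < gapH mu T D.
Proof.
  intros Hm HT HD; unfold gapH, gapZ.
  assert (a0 : 0 < mu / (2 * T)) by (apply Rdiv_lt_0_compat; lra).
  assert (d0 : 0 < D / (2 * T)) by (apply Rdiv_lt_0_compat; lra).
  assert (P := Psi_gt_asinh _ _ a0 d0); rewrite asinh_scale in P by auto.
  assert (L1 := lcosh_gt (rad xm T D)).
  assert (L2 := lcosh_le_id (rad mu T D) (Rlt_le _ _ (rad_pos mu T D HT HD))).
  assert (E : forall a, sqrt (a ^ 2 + D ^ 2) = 2 * T * rad a T D)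
    by (intros; unfold rad; field; lra).
  rewrite (E xm), (E mu) at 1.
  replace (T * (2 * ln 2 + 2 * mu ^ 2 / D ^ 2))
    with (2 * T * ln 2 + mu * (mu / (2 * T) / (D / (2 * T)) ^ 2)) by (field; lra).
  nra.
Qed.

Lemma gapG_solution mu c : 0 < mu <= xm -> 0 < c -> exists T, 0 < T /\ gapG mu T = c.
Proof.
  intros Hm Hc.
  assert (t1 := tanh_pos 1 Rlt_0_1).
  (* Chosen so that [tanh 1 * ln a = c / mu]: at the temperature [mu / (2 * a)] the term
     [mu * psi a] alone exceeds [c]. *)
  set (a := exp (c / (mu * tanh 1))).
  assert (e0 : 0 < c / (mu * tanh 1)) by (apply Rdiv_lt_0_compat; nra).
  assert (a1 : 1 < a) by (unfold a; generalize (exp_ineq1 _ (Rgt_not_eq _ _ e0)); lra).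
  assert (T1 : 0 < mu / (2 * a)) by (apply Rdiv_lt_0_compat; lra).
  (* At this temperature the log cosh part is below [c / 2] by the quadratic bound, and the [psi]
     part is below [c / 2] by [psi_lt_id] and [mu <= xm]. *)
  assert (T2 : 0 < xm ^ 2 / c) by (apply Rdiv_lt_0_compat; nra).
  destruct (decreasing_IVT (gapG mu) (gapG_T xm mu) c (mu / (2 * a)) (xm ^ 2 / c)) as [T [HT E]]; auto.
  - intros; apply is_derive_gapG_T; lra.
  - intros; apply gapG_decr; lra.
  - unfold gapG.
    set (t := mu / (2 * a)) in *.
    assert (Ea : mu / (2 * t) = a) by (unfold t; field; lra).
    assert (B : mu / (2 * t) <= xm / (2 * t)).
    { apply Rmult_le_compat_r; [left; apply Rinv_0_lt_compat|]; lra. }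
    rewrite Ea in *.
    assert (L := lcosh_le a (xm / (2 * t)) ltac:(lra)).
    assert (P := psi_gt_ln a a1); unfold a in P at 1; rewrite ln_exp in P.
    replace (tanh 1 * (c / (mu * tanh 1))) with (c / mu) in P by (field; lra).
    assert (c < mu * psi a); [|nra].
    replace c with (mu * (c / mu)) at 1 by (field; lra). apply Rmult_lt_compat_l; lra.
  - unfold gapG.
    set (t := xm ^ 2 / c) in *.
    assert (x0 : 0 < xm / (2 * t)) by (apply Rdiv_lt_0_compat; lra).
    assert (m0 : 0 < mu / (2 * t)) by (apply Rdiv_lt_0_compat; lra).
    assert (L1 := lcosh_lt_sqr _ x0).
    assert (L2 := lcosh_le 0 _ (conj (Rle_refl 0) (Rlt_le _ _ m0))); rewrite lcosh_0 in L2.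
    assert (P := psi_lt_id _ m0).
    assert (K1 : 2 * t * (xm / (2 * t)) ^ 2 = c / 2) by (unfold t; field; lra).
    assert (K2 : mu * (mu / (2 * t)) <= c / 2).
    { replace (c / 2) with (xm * (xm / (2 * t))) by (unfold t; field; lra).
      assert (mu / (2 * t) <= xm / (2 * t)).
      { apply Rmult_le_compat_r; [left; apply Rinv_0_lt_compat|]; lra. }
      nra. }
    nra.
  - exists T; split; [lra|exact E].
Qed.

Lemma gapZ_solution mu c : 0 < mu <= xm -> 0 < c -> exists D, 0 < D /\ gapZ mu D = c.
Proof.
  intros Hm Hc.
  (* Here [mu / D = exp (c / mu)], so the logarithmic term alone exceeds [c]. *)
  assert (D1 : 0 < mu * exp (- (c / mu))) by (generalize (exp_pos (- (c / mu))); nra).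
  (* Here [xm ^ 2 / D = c / 3]. The square roots contribute at most half of it and the logarithm at
     most twice it, in total 5c/6. *)
  assert (D2 : 0 < 3 * xm ^ 2 / c) by (apply Rdiv_lt_0_compat; nra).
  destruct (decreasing_IVT (gapZ mu) (gapZ_D xm mu) c (mu * exp (- (c / mu))) (3 * xm ^ 2 / c))
    as [D [HD E]]; auto.
  - intros; apply is_derive_gapZ_D; lra.
  - intros; apply gapZ_decr; lra.
  - unfold gapZ; set (D := mu * exp (- (c / mu))) in *.
    assert (A := hypot_le_l mu xm D ltac:(lra)).
    assert (S := hypot_pos mu D D1).
    assert (K : c / mu < ln ((mu + sqrt (mu ^ 2 + D ^ 2)) / D)).
    { rewrite <- (ln_exp (c / mu)); apply ln_increasing; [apply exp_pos|].
      apply Rmult_lt_reg_r with D; auto.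
      replace ((mu + sqrt (mu ^ 2 + D ^ 2)) / D * D) with (mu + sqrt (mu ^ 2 + D ^ 2))
        by (field; lra).
      replace (exp (c / mu) * D) with mu; [lra|].
      unfold D; rewrite Rmult_comm, Rmult_assoc, <- exp_plus, Rplus_opp_l, exp_0; ring. }
    replace c with (mu * (c / mu)) at 1 by (field; lra). nra.
  - unfold gapZ; set (D := 3 * xm ^ 2 / c) in *.
    assert (S := hypot_pos mu D D2).
    assert (A1 : D <= sqrt (mu ^ 2 + D ^ 2)) by (rewrite Rplus_comm; apply hypot_ge; lra).
    assert (A2 : sqrt (xm ^ 2 + D ^ 2) <= D + xm ^ 2 / (2 * D)).
    { assert (0 < xm ^ 2 / (2 * D)) by (apply Rdiv_lt_0_compat; nra).
      rewrite <- (sqrt_pow2 (D + _)) by lra. apply sqrt_le_1; try nra.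
      replace ((D + xm ^ 2 / (2 * D)) ^ 2) with (xm ^ 2 + D ^ 2 + (xm ^ 2 / (2 * D)) ^ 2)
        by (field; lra). nra. }
    assert (A3 : sqrt (mu ^ 2 + D ^ 2) <= mu + D) by (apply hypot_le; lra).
    assert (i0 := Rinv_0_lt_compat _ D2).
    assert (A4 : ln ((mu + sqrt (mu ^ 2 + D ^ 2)) / D) <= 2 * mu / D).
    { assert (P : 0 < (mu + sqrt (mu ^ 2 + D ^ 2)) / D) by (apply Rdiv_lt_0_compat; lra).
      assert (K := exp_ineq1_le (ln ((mu + sqrt (mu ^ 2 + D ^ 2)) / D))).
      rewrite exp_ln in K by auto.
      assert ((mu + sqrt (mu ^ 2 + D ^ 2)) / D <= 1 + 2 * mu / D); [|lra].
      replace (1 + 2 * mu / D) with ((mu + (mu + D)) / D) by (field; lra).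
      apply Rmult_le_compat_r; lra. }
    assert (c3 : xm ^ 2 / D = c / 3) by (unfold D; field; lra).
    assert (A5 : mu * (2 * mu / D) <= 2 * (xm ^ 2 / D)).
    { replace (mu * (2 * mu / D)) with (2 * (mu ^ 2 * / D)) by (field; lra).
      unfold Rdiv; assert (mu ^ 2 <= xm ^ 2) by nra. nra. }
    replace (xm ^ 2 / (2 * D)) with (xm ^ 2 / D / 2) in A2 by (field; lra).
    nra.
  - exists D; split; [lra|exact E].
Qed.

(** * The solutions and their limits *)

Lemma coupling_pos lam : 0 < lam -> 0 < xm / lam.
Proof. intros; apply Rdiv_lt_0_compat; lra. Qed.

(** A pointwise choice: strict monotonicity makes it the only solution, and the implicit function
    theorem supplies its smoothness. *)
Definition Tc (mu lam : R) : R := epsilon (inhabits 0) (fun T => 0 < T /\ gapG mu T = xm / lam).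

Lemma Tc_spec mu lam : 0 < mu <= xm -> 0 < lam -> 0 < Tc mu lam /\ gapG mu (Tc mu lam) = xm / lam.
Proof.
  intros Hm Hl; unfold Tc; apply epsilon_spec, gapG_solution; auto using coupling_pos.
Qed.

Definition D0 (mu lam : R) : R := epsilon (inhabits 0) (fun D => 0 < D /\ gapZ mu D = xm / lam).

Lemma D0_spec mu lam : 0 < mu <= xm -> 0 < lam -> 0 < D0 mu lam /\ gapZ mu (D0 mu lam) = xm / lam.
Proof.
  intros Hm Hl; unfold D0; apply epsilon_spec, gapZ_solution; auto using coupling_pos.
Qed.

(** From [Tc] on the trivial solution is taken, so the comparison with [D0] makes sense for all
    [T > 0]. *)
Definition Dl (mu T lam : R) : R :=
  if Rlt_dec T (Tc mu lam)
  then epsilon (inhabits 0) (fun D => 0 < D /\ gapH mu T D = xm / lam) else 0.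

Lemma Dl_spec mu T lam : 0 < mu <= xm -> 0 < lam -> 0 < T < Tc mu lam ->
  0 < Dl mu T lam /\ gapH mu T (Dl mu T lam) = xm / lam.
Proof.
  intros Hm Hl HT; unfold Dl; destruct (Rlt_dec T (Tc mu lam)) as [L|L]; [|lra].
  apply epsilon_spec.
  destruct (Tc_spec mu lam Hm Hl) as [P E], (D0_spec mu lam Hm Hl) as [P' E'].
  assert (K := gapG_decr xm mu T (Tc mu lam) Hm HT).
  assert (a0 : 0 < mu / (2 * T)) by (apply Rdiv_lt_0_compat; lra).
  (* This [e] turns the lower bound of [gapH_gt_G_minus] into exactly [xm / lam]. The other test
     point is [D0], where [gapH] lies below [gapZ]. *)
  set (e := (gapG mu T - xm / lam) / (1 + mu / (2 * T))).
  assert (e0 : 0 < e) by (apply Rdiv_lt_0_compat; lra).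
  destruct (decreasing_IVT (gapH mu T) (gapH_D xm mu T) (xm / lam) e (D0 mu lam)) as [D [HD F]]; auto.
  - intros; apply is_derive_gapH_D; lra.
  - intros; apply gapH_decr_D; lra.
  - assert (Q := gapH_gt_G_minus mu T e Hm ltac:(lra) e0).
    replace (e * (1 + mu / (2 * T))) with (gapG mu T - xm / lam) in Q by (unfold e; field; lra).
    lra.
  - rewrite <- E'; apply gapH_lt_Z; lra.
  - exists D; split; [lra|exact F].
Qed.

Lemma gapH_lt_reg mu T D E : 0 < mu <= xm -> 0 < T -> 0 < D -> 0 < E ->
  gapH mu T D < gapH mu T E -> E < D.
Proof.
  intros Hm HT HD HE L; apply Rnot_le_lt; intros [C|C]; [|subst; lra].
  generalize (gapH_decr_D xm mu T D E Hm HT ltac:(lra)); lra.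
Qed.

Lemma gapH_inj mu T D E : 0 < mu <= xm -> 0 < T -> 0 < D -> 0 < E ->
  gapH mu T D = gapH mu T E -> D = E.
Proof.
  intros Hm HT HD HE L; destruct (Rtotal_order D E) as [C|[C|C]]; auto.
  - generalize (gapH_decr_D xm mu T D E Hm HT ltac:(lra)); lra.
  - generalize (gapH_decr_D xm mu T E D Hm HT ltac:(lra)); lra.
Qed.

Lemma gapZ_lt_reg mu D E : 0 < mu <= xm -> 0 < D -> 0 < E -> gapZ mu D < gapZ mu E -> E < D.
Proof.
  intros Hm HD HE L; apply Rnot_le_lt; intros [C|C]; [|subst; lra].
  generalize (gapZ_decr xm mu D E Hm ltac:(lra)); lra.
Qed.

Lemma gapZ_inj mu D E : 0 < mu <= xm -> 0 < D -> 0 < E -> gapZ mu D = gapZ mu E -> D = E.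
Proof.
  intros Hm HD HE L; destruct (Rtotal_order D E) as [C|[C|C]]; auto.
  - generalize (gapZ_decr xm mu D E Hm ltac:(lra)); lra.
  - generalize (gapZ_decr xm mu E D Hm ltac:(lra)); lra.
Qed.

Lemma gapG_inj mu T T' : 0 < mu <= xm -> 0 < T -> 0 < T' -> gapG mu T = gapG mu T' -> T = T'.
Proof.
  intros Hm HT HT' L; destruct (Rtotal_order T T') as [C|[C|C]]; auto.
  - generalize (gapG_decr xm mu T T' Hm ltac:(lra)); lra.
  - generalize (gapG_decr xm mu T' T Hm ltac:(lra)); lra.
Qed.

Lemma Dl_lt_D0 mu T lam : 0 < mu <= xm -> 0 < lam -> 0 < T -> 0 <= Dl mu T lam < D0 mu lam.
Proof.
  intros Hm Hl HT; destruct (D0_spec mu lam Hm Hl) as [P E].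
  destruct (Rlt_dec T (Tc mu lam)) as [L|L].
  - destruct (Dl_spec mu T lam Hm Hl ltac:(lra)) as [Q F]; split; [lra|].
    apply gapH_lt_reg with mu T; auto. rewrite F, <- E; now apply gapH_lt_Z.
  - unfold Dl; destruct (Rlt_dec T (Tc mu lam)); lra.
Qed.

Lemma no_gap_above_Tc mu T lam D : 0 < mu <= xm -> 0 < lam -> Tc mu lam <= T -> 0 < D ->
  gapH mu T D < xm / lam.
Proof.
  intros Hm Hl HT HD; destruct (Tc_spec mu lam Hm Hl) as [P E].
  apply Rlt_le_trans with (gapG mu T); [apply gapH_lt_G; lra|].
  rewrite <- E; destruct HT as [HT|HT]; [left; apply gapG_decr; lra|rewrite HT; lra].
Qed.

(** At [T = Tc] the value of [gapH] at the gap [eps] is already below [xm / lam]. By continuity in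
    [T] it stays below slightly under [Tc], so the solution is smaller than [eps]. The minimum with
    [Tc] keeps [T] positive. *)
Lemma Dl_to_0 mu lam eps : 0 < mu <= xm -> 0 < lam -> 0 < eps -> exists d, 0 < d /\
  forall T, Tc mu lam - d < T < Tc mu lam -> Rabs (Dl mu T lam) < eps.
Proof.
  intros Hm Hl He; destruct (Tc_spec mu lam Hm Hl) as [P E].
  assert (L := no_gap_above_Tc mu _ lam eps Hm Hl (Rle_refl _) He).
  assert (C := is_derive_continuity_pt _ _ _ (is_derive_gapH_T xm mu (Tc mu lam) eps P He)).
  destruct (C (xm / lam - gapH mu (Tc mu lam) eps) ltac:(lra)) as [d [Hd K]].
  exists (Rmin d (Tc mu lam)); split; [now apply Rmin_pos|].
  intros T HT; generalize (Rmin_l d (Tc mu lam)), (Rmin_r d (Tc mu lam)); intros R1 R2.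
  destruct (Dl_spec mu T lam Hm Hl ltac:(lra)) as [Q F].
  rewrite Rabs_pos_eq by lra.
  apply gapH_lt_reg with mu T; auto; [lra|]. rewrite F.
  assert (K' := K T); simpl in K'; unfold Rdist in K'.
  assert (J : Rabs (gapH mu T eps - gapH mu (Tc mu lam) eps) < xm / lam - gapH mu (Tc mu lam) eps).
  { apply K'; split; [split; [exact I|lra]|]. apply Rabs_def1; lra. }
  apply Rabs_def2 in J; lra.
Qed.

(** Just below [D0], at a gap [D], the value of [gapZ] exceeds [xm / lam] by a fixed amount. For
    small [T] the error [T * N] is less than that, so [gapH] still exceeds [xm / lam] at [D] and the
    solution lies between [D] and [D0]. *)
Lemma Dl_to_D0 mu lam eps : 0 < mu <= xm -> 0 < lam -> 0 < eps -> exists d, 0 < d /\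
  forall T, 0 < T < d -> Rabs (Dl mu T lam - D0 mu lam) < eps.
Proof.
  intros Hm Hl He; destruct (Tc_spec mu lam Hm Hl) as [P E].
  destruct (D0_spec mu lam Hm Hl) as [P' E'].
  (* The second entry keeps [D] positive when [eps] is large. *)
  set (D := Rmax (D0 mu lam - eps) (D0 mu lam / 2)).
  assert (B1 : D0 mu lam - eps <= D) by apply Rmax_l.
  assert (B2 : D0 mu lam / 2 <= D) by apply Rmax_r.
  assert (B3 : D < D0 mu lam) by (apply Rmax_lub_lt; lra).
  assert (K := gapZ_decr xm mu D (D0 mu lam) Hm ltac:(lra)); rewrite E' in K.
  set (N := 2 * ln 2 + 2 * mu ^ 2 / D ^ 2).
  assert (HN : 0 < N).
  { assert (0 < ln 2) by (rewrite <- ln_1; apply ln_increasing; lra).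
    assert (0 < 2 * mu ^ 2 / D ^ 2) by (apply Rdiv_lt_0_compat; nra).
    unfold N; lra. }
  exists (Rmin (Tc mu lam) ((gapZ mu D - xm / lam) / N)).
  split; [apply Rmin_pos; auto; apply Rdiv_lt_0_compat; lra|].
  intros T [HT1 HT2].
  assert (L1 : T < Tc mu lam) by (eapply Rlt_le_trans; [exact HT2|apply Rmin_l]).
  assert (L2 : T < (gapZ mu D - xm / lam) / N) by (eapply Rlt_le_trans; [exact HT2|apply Rmin_r]).
  destruct (Dl_spec mu T lam Hm Hl ltac:(lra)) as [Q F].
  assert (J := Dl_lt_D0 mu T lam Hm Hl HT1).
  assert (D < Dl mu T lam).
  { apply gapH_lt_reg with mu T; auto; [lra|]. rewrite F.
    assert (X := gapH_gt_Z_minus mu T D Hm HT1 ltac:(lra)); fold N in X.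
    assert (T * N < gapZ mu D - xm / lam); [|lra].
    replace (gapZ mu D - xm / lam) with ((gapZ mu D - xm / lam) / N * N) by (field; lra).
    apply Rmult_lt_compat_r; auto. }
  apply Rabs_def1; lra.
Qed.

(** * Explicit values at the ends of the doping range *)

Lemma gapZ_at_xm lam : 0 < lam -> gapZ xm (xm / sinh (/ lam)) = xm / lam.
Proof.
  intros Hl; assert (l0 := Rinv_0_lt_compat _ Hl).
  assert (S := sinh_pos _ l0); assert (C := cosh_pos (/ lam)); assert (I := cosh2_sinh2 (/ lam)).
  set (s := sinh (/ lam)) in *; set (c := cosh (/ lam)) in *.
  (* The square roots cancel, and what remains is the equation arsinh (xm / D) = 1 / lam. *)
  unfold gapZ; rewrite Rminus_diag, Rplus_0_l.
  replace (xm ^ 2 + (xm / s) ^ 2) with ((xm * c / s) ^ 2).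
  2:{ replace ((xm * c / s) ^ 2) with (xm ^ 2 * c ^ 2 / s ^ 2) by (field; lra).
      replace (c ^ 2) with (1 + s ^ 2) by lra. field; lra. }
  rewrite sqrt_pow2 by (left; apply Rdiv_lt_0_compat; nra).
  replace ((xm + xm * c / s) / (xm / s)) with (exp (/ lam)).
  - rewrite ln_exp; reflexivity.
  - replace (exp (/ lam)) with (s + c) by (unfold s, c, sinh, cosh; field).
    field; lra.
Qed.

Lemma gapZ_at_0 D : 0 < D -> gapZ 0 D = sqrt (xm ^ 2 + D ^ 2) - D.
Proof.
  intros HD; unfold gapZ; replace (0 ^ 2 + D ^ 2) with (D ^ 2) by ring.
  rewrite sqrt_pow2 by lra; ring.
Qed.

(** Squaring sqrt (xm^2 + D^2) = xm / lam + D leaves a linear equation for [D], and [D > 0] then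
    forces [lam > 1]. Conversely the radicand is the square of [xm / 2 * (lam + / lam)]. *)
Lemma gap0_at_0 lam D : 0 < lam -> 0 < D ->
  (gap0 xm 0 lam D <-> (1 < lam /\ D = xm / 2 * (lam - / lam))).
Proof.
  intros Hl HD; change (gap0 xm 0 lam D) with (xm / lam = gapZ 0 D); rewrite gapZ_at_0 by auto.
  assert (l0 := Rinv_0_lt_compat _ Hl); assert (li : lam * / lam = 1) by (apply Rinv_r; lra).
  split.
  - intros E.
    assert (Q := sqrt_def (xm ^ 2 + D ^ 2) ltac:(nra)).
    replace (sqrt (xm ^ 2 + D ^ 2)) with (xm / lam + D) in Q by lra.
    assert (F : D = xm / 2 * (lam - / lam)).
    { apply Rmult_eq_reg_l with (2 * (xm / lam)); [|generalize (coupling_pos lam Hl); lra].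
      transitivity (xm ^ 2 - (xm / lam) ^ 2); [nra|field; lra]. }
    split; auto.
    assert (0 < lam - / lam) by nra. nra.
  - intros [L ->].
    replace (xm ^ 2 + (xm / 2 * (lam - / lam)) ^ 2) with ((xm / 2 * (lam + / lam)) ^ 2)
      by (field; lra).
    rewrite sqrt_pow2 by nra. field; lra.
Qed.

(** [gapZ] increases in [mu] and decreases in [D], so its level set at [mu] lies strictly between
    those at 0 and at [xm], which are explicit. *)
Lemma D0_bounds mu lam : 0 < mu < xm -> 0 < lam ->
  xm / 2 * (lam - / lam) < D0 mu lam < xm / sinh (/ lam).
Proof.
  intros Hm Hl; destruct (D0_spec mu lam ltac:(lra) Hl) as [P E].
  assert (l0 := Rinv_0_lt_compat _ Hl); assert (S := sinh_pos _ l0).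
  split.
  (* When the left-hand side is not positive it is no solution at [mu = 0], but then [D0 > 0]
     settles the bound. *)
  - destruct (Rle_dec (xm / 2 * (lam - / lam)) 0) as [L|L]; [lra|].
    apply gapZ_lt_reg with mu; try lra. rewrite E.
    assert (lam * / lam = 1) by (apply Rinv_r; lra).
    assert (0 < lam - / lam) by nra.
    assert (L1 : 1 < lam) by nra.
    destruct (gap0_at_0 lam (xm / 2 * (lam - / lam)) Hl ltac:(lra)) as [_ K].
    rewrite (K (conj L1 eq_refl)); apply gapZ_incr_mu; lra.
  - assert (X : 0 < xm / sinh (/ lam)) by (apply Rdiv_lt_0_compat; lra).
    apply gapZ_lt_reg with mu; try lra. rewrite E, <- (gapZ_at_xm lam) by auto.
    apply gapZ_incr_mu; lra.
Qed.

(** By the Lipschitz bound for [lcosh], dividing by [D] gives xm / lam <= sqrt (xm^2 + D^2) - D,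
    which is less than [xm]. *)
Lemma gapR_at_0 T lam D : 0 < T -> 0 < lam -> 0 < D -> gapR xm 0 T lam D -> 1 < lam.
Proof.
  intros HT Hl HD K; unfold gapR in K.
  rewrite Rmult_0_l, Rplus_0_r, ln_cosh_div in K.
  fold (rad xm T D) (rad 0 T D) in K; apply Rmult_eq_reg_r in K; [|lra].
  assert (L := lcosh_lip _ _ (rad_le 0 xm T D HT ltac:(lra))).
  assert (E : forall a, 2 * T * rad a T D = sqrt (a ^ 2 + D ^ 2))
    by (intros; unfold rad; field; lra).
  assert (F := gapZ_at_0 D HD); unfold gapZ in F; rewrite <- !E in F.
  assert (B : sqrt (xm ^ 2 + D ^ 2) < xm + D).
  { rewrite <- (sqrt_pow2 (xm + D)) by lra; apply sqrt_lt_1; nra. }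
  rewrite <- E in B.
  assert (xm / lam < xm) by nra.
  apply Rmult_lt_reg_r with (xm / lam); [now apply coupling_pos|].
  replace (lam * (xm / lam)) with xm by (field; lra). lra.
Qed.

Lemma has_pderiv_coupling U j x f : 0 < x j ->
  (forall t, f (upd x j t) = f x) ->
  has_pderiv_within U (fun z => f z - xm / z j) j x (xm / x j ^ 2).
Proof.
  intros Hl Hf; apply has_pderiv_within_derive.
  apply is_derive_ext with (fun t => f x - xm / t).
  - intros t; now rewrite upd_eq, Hf.
  - auto_derive; [lra|field; lra].
Qed.

(** * Smoothness and signs of the partial derivatives *)

Definition U3 (x : nat -> R) : Prop :=
  0 < x 0%nat <= xm /\ 0 < x 2%nat /\ 0 < x 1%nat < Tc (x 0%nat) (x 2%nat).
Definition U2 (x : nat -> R) : Prop := 0 < x 0%nat <= xm /\ 0 < x 1%nat.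

Lemma Ck_coupling n U k j : (j < n)%nat -> (forall x, U x -> 0 < x j) ->
  Ck n k U (fun x => xm / x j).
Proof.
  intros Hj HU; apply Ck_div; auto using Ck_const, Ck_proj.
  intros x Ux; generalize (HU x Ux); lra.
Qed.

Lemma Ck_coupling2 n U k j : (j < n)%nat -> (forall x, U x -> 0 < x j) ->
  Ck n k U (fun x => xm / x j ^ 2).
Proof.
  intros Hj HU; apply Ck_div; auto using Ck_const, Ck_proj, Ck_pow.
  intros x Ux; generalize (HU x Ux); nra.
Qed.

Lemma is_derive_minus_const (f : R -> R) c x l : is_derive f x l -> is_derive (fun y => f y - c) x l.
Proof.
  intros K; evar_last.
  - apply (is_derive_minus f (fun _ => c)); [exact K|apply (is_derive_const (V := R_NormedModule))].
  - apply (minus_zero_r (G := R_AbelianGroup)).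
Qed.

(** For F = gapH - xm / lam the derivatives in [mu], [T], [lam] have signs +, -, +. Since F
    decreases in the unknown, -F_i / F_y inherits exactly these signs. *)
Lemma Dl_smooth :
  Smooth 3 U3 (fun x => Dl (x 0%nat) (x 1%nat) (x 2%nat)) /\
  pos_pderiv U3 (fun x => Dl (x 0%nat) (x 1%nat) (x 2%nat)) 0 /\
  neg_pderiv U3 (fun x => Dl (x 0%nat) (x 1%nat) (x 2%nat)) 1 /\
  pos_pderiv U3 (fun x => Dl (x 0%nat) (x 1%nat) (x 2%nat)) 2.
Proof.
  set (phi := fun x : nat -> R => Dl (x 0%nat) (x 1%nat) (x 2%nat)).
  set (Fi := fun (i : nat) (x : nat -> R) (y : R) =>
    match i with
    | O => gapH_mu (x 0%nat) (x 1%nat) y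
    | S O => gapH_T xm (x 0%nat) (x 1%nat) y
    | _ => xm / x 2%nat ^ 2
    end).
  assert (S3 : forall x, U3 x -> 0 < phi x /\ gapH (x 0%nat) (x 1%nat) (phi x) = xm / x 2%nat).
  { intros x [Hm [Hl HT]]; now apply Dl_spec. }
  destruct (implicit_Smooth 3 U3 (fun x y => gapH (x 0%nat) (x 1%nat) y - xm / x 2%nat)
    (fun x y => gapH_D xm (x 0%nat) (x 1%nat) y) Fi phi) as [Sm Pd].
  - auto.
  - auto.
  - intros x Ux; destruct (S3 x Ux); split; lra.
  - intros x y [Hm [Hl HT]] Hy; split; [|apply gapH_D_neg; lra].
    apply is_derive_minus_const, is_derive_gapH_D; lra.
  - intros x i Ux Hi; destruct (S3 x Ux) as [P _]; destruct Ux as [Hm [Hl HT]].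
    destruct i as [|[|[|i]]]; [| | |lia]; simpl.
    + apply has_pderiv_within_derive; exact (is_derive_minus_const _ (xm / x 2%nat) _ _
        (is_derive_gapH_mu xm (x 0%nat) (x 1%nat) (phi x) (proj1 HT) P)).
    + apply has_pderiv_within_derive; exact (is_derive_minus_const _ (xm / x 2%nat) _ _
        (is_derive_gapH_T xm (x 0%nat) (x 1%nat) (phi x) (proj1 HT) P)).
    + apply (has_pderiv_coupling U3 2 x (fun z => gapH (z 0%nat) (z 1%nat) (phi x))); auto.
  - intros y Hy; apply Ck_cont with 0%nat, Ck_minus.
    + apply Ck_gapH; try (intros x [Hm [Hl HT]]; lra); try (apply Ck_proj; lia).
      * auto.
      * apply Ck_const.
    + apply Ck_coupling; [lia|now intros x [_ [Hl _]]].
  (* Coordinate 3 holds the gap, which gives joint continuity in parameters and unknown. *)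
  - apply Ck_cont with 0%nat.
    apply Ck_gapH_D with (d := fun z => z 3%nat);
      try (intros x [[Hm [Hl HT]] Hx]; lra); apply Ck_proj; lia.
  - intros k Ck; split.
    + apply Ck_gapH_D; auto; try (intros x [Hm [Hl HT]]; lra); try (apply Ck_proj; lia).
      intros x Ux; now apply S3.
    + intros i Hi; destruct i as [|[|[|i]]]; [| | |lia]; simpl.
      * apply Ck_Psi; auto; try (intros x [Hm [Hl HT]]; lra); try (apply Ck_proj; lia).
        intros x Ux; now apply S3.
      * apply Ck_gapH_T; auto; try (intros x [Hm [Hl HT]]; lra); try (apply Ck_proj; lia).
        intros x Ux; now apply S3.
      * apply Ck_coupling2; [lia|now intros x [_ [Hl _]]].
  - split; [exact Sm|].
    assert (N : forall x, U3 x -> gapH_D xm (x 0%nat) (x 1%nat) (phi x) < 0).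
    { intros x Ux; destruct (S3 x Ux) as [P _]; destruct Ux as [Hm [Hl HT]].
      apply gapH_D_neg; lra. }
    split; [|split]; intros x Ux; assert (Nx := N x Ux); destruct (S3 x Ux) as [P _].
    + eexists; split; [apply (Pd x 0%nat Ux); lia|]. destruct Ux as [Hm [Hl HT]]; simpl.
      apply Rdiv_neg_neg; auto; generalize (gapH_mu_pos (x 0%nat) (x 1%nat) (phi x)); lra.
    + eexists; split; [apply (Pd x 1%nat Ux); lia|]. destruct Ux as [Hm [Hl HT]]; simpl.
      apply Rdiv_pos_neg; auto; generalize (gapH_T_neg xm (x 0%nat) (x 1%nat) (phi x)); lra.
    + eexists; split; [apply (Pd x 2%nat Ux); lia|]. destruct Ux as [Hm [Hl HT]].
      apply Rdiv_neg_neg; auto; simpl.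
      apply Ropp_lt_gt_0_contravar, Rdiv_lt_0_compat; nra.
Qed.

Lemma Tc_smooth :
  Smooth 2 U2 (fun x => Tc (x 0%nat) (x 1%nat)) /\
  pos_pderiv U2 (fun x => Tc (x 0%nat) (x 1%nat)) 0 /\
  pos_pderiv U2 (fun x => Tc (x 0%nat) (x 1%nat)) 1.
Proof.
  set (phi := fun x : nat -> R => Tc (x 0%nat) (x 1%nat)).
  set (Fi := fun (i : nat) (x : nat -> R) (y : R) =>
    match i with
    | O => gapG_mu (x 0%nat) y
    | _ => xm / x 1%nat ^ 2
    end).
  assert (S2 : forall x, U2 x -> 0 < phi x /\ gapG (x 0%nat) (phi x) = xm / x 1%nat).
  { intros x [Hm Hl]; now apply Tc_spec. }
  destruct (implicit_Smooth 2 U2 (fun x y => gapG (x 0%nat) y - xm / x 1%nat)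
    (fun x y => gapG_T xm (x 0%nat) y) Fi phi) as [Sm Pd].
  - auto.
  - auto.
  - intros x Ux; destruct (S2 x Ux); split; lra.
  - intros x y [Hm Hl] Hy; split; [|apply gapG_T_neg; lra].
    apply is_derive_minus_const, is_derive_gapG_T; lra.
  - intros x i Ux Hi; destruct (S2 x Ux) as [P _]; destruct Ux as [Hm Hl].
    destruct i as [|[|i]]; [| |lia]; simpl.
    + apply has_pderiv_within_derive; exact (is_derive_minus_const _ (xm / x 1%nat) _ _
        (is_derive_gapG_mu xm (x 0%nat) (phi x) (proj1 Hm) P)).
    + apply (has_pderiv_coupling U2 1 x (fun z => gapG (z 0%nat) (phi x))); auto.
  - intros y Hy; apply Ck_cont with 0%nat, Ck_minus.
    + apply Ck_gapG; try (intros x [Hm Hl]; lra); try (apply Ck_proj; lia).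
      * auto.
      * apply Ck_const.
    + apply Ck_coupling; [lia|now intros x [_ Hl]].
  - apply Ck_cont with 0%nat.
    apply Ck_gapG_T with (t := fun z => z 2%nat);
      try (intros x [[Hm Hl] Hx]; lra); apply Ck_proj; lia.
  - intros k Ck; split.
    + apply Ck_gapG_T; auto; try (intros x [Hm Hl]; lra); try (apply Ck_proj; lia).
      intros x Ux; now apply S2.
    + intros i Hi; destruct i as [|[|i]]; [| |lia]; simpl.
      * apply Ck_gapG_mu; auto; try (intros x [Hm Hl]; lra); try (apply Ck_proj; lia).
        intros x Ux; now apply S2.
      * apply Ck_coupling2; [lia|now intros x [_ Hl]].
  - split; [exact Sm|].
    assert (N : forall x, U2 x -> gapG_T xm (x 0%nat) (phi x) < 0).
    { intros x Ux; destruct (S2 x Ux) as [P _]; destruct Ux as [Hm Hl].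
      apply gapG_T_neg; lra. }
    split; intros x Ux; assert (Nx := N x Ux); destruct (S2 x Ux) as [P _].
    + eexists; split; [apply (Pd x 0%nat Ux); lia|]. destruct Ux as [Hm Hl]; simpl.
      apply Rdiv_neg_neg; auto; generalize (gapG_mu_pos (x 0%nat) (phi x)); lra.
    + eexists; split; [apply (Pd x 1%nat Ux); lia|]. destruct Ux as [Hm Hl].
      apply Rdiv_neg_neg; auto; simpl.
      apply Ropp_lt_gt_0_contravar, Rdiv_lt_0_compat; nra.
Qed.

Lemma D0_smooth :
  Smooth 2 U2 (fun x => D0 (x 0%nat) (x 1%nat)) /\
  pos_pderiv U2 (fun x => D0 (x 0%nat) (x 1%nat)) 0 /\
  pos_pderiv U2 (fun x => D0 (x 0%nat) (x 1%nat)) 1.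
Proof.
  set (phi := fun x : nat -> R => D0 (x 0%nat) (x 1%nat)).
  set (Fi := fun (i : nat) (x : nat -> R) (y : R) =>
    match i with
    | O => gapZ_mu (x 0%nat) y
    | _ => xm / x 1%nat ^ 2
    end).
  assert (S2 : forall x, U2 x -> 0 < phi x /\ gapZ (x 0%nat) (phi x) = xm / x 1%nat).
  { intros x [Hm Hl]; now apply D0_spec. }
  destruct (implicit_Smooth 2 U2 (fun x y => gapZ (x 0%nat) y - xm / x 1%nat)
    (fun x y => gapZ_D xm (x 0%nat) y) Fi phi) as [Sm Pd].
  - auto.
  - auto.
  - intros x Ux; destruct (S2 x Ux); split; lra.
  - intros x y [Hm Hl] Hy; split; [|apply gapZ_D_neg; lra].
    apply is_derive_minus_const, is_derive_gapZ_D; lra.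
  - intros x i Ux Hi; destruct (S2 x Ux) as [P _]; destruct Ux as [Hm Hl].
    destruct i as [|[|i]]; [| |lia]; simpl.
    + apply has_pderiv_within_derive; exact (is_derive_minus_const _ (xm / x 1%nat) _ _
        (is_derive_gapZ_mu xm (x 0%nat) (phi x) P)).
    + apply (has_pderiv_coupling U2 1 x (fun z => gapZ (z 0%nat) (phi x))); auto.
  - intros y Hy; apply Ck_cont with 0%nat, Ck_minus.
    + apply Ck_gapZ; try (intros x [Hm Hl]; lra); try (apply Ck_proj; lia).
      * auto.
      * apply Ck_const.
    + apply Ck_coupling; [lia|now intros x [_ Hl]].
  - apply Ck_cont with 0%nat.
    apply Ck_gapZ_D with (d := fun z => z 2%nat);
      try (intros x [[Hm Hl] Hx]; lra); apply Ck_proj; lia.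
  - intros k Ck; split.
    + apply Ck_gapZ_D; auto; try (intros x [Hm Hl]; lra); try (apply Ck_proj; lia).
      intros x Ux; now apply S2.
    + intros i Hi; destruct i as [|[|i]]; [| |lia]; simpl.
      * apply Ck_gapZ_mu; auto; try (intros x [Hm Hl]; lra); try (apply Ck_proj; lia).
        intros x Ux; now apply S2.
      * apply Ck_coupling2; [lia|now intros x [_ Hl]].
  - split; [exact Sm|].
    assert (N : forall x, U2 x -> gapZ_D xm (x 0%nat) (phi x) < 0).
    { intros x Ux; destruct (S2 x Ux) as [P _]; destruct Ux as [Hm Hl].
      apply gapZ_D_neg; lra. }
    split; intros x Ux; assert (Nx := N x Ux); destruct (S2 x Ux) as [P _].
    + eexists; split; [apply (Pd x 0%nat Ux); lia|]. destruct Ux as [Hm Hl]; simpl.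
      apply Rdiv_neg_neg; auto; generalize (gapZ_mu_pos (x 0%nat) (phi x)); lra.
    + eexists; split; [apply (Pd x 1%nat Ux); lia|]. destruct Ux as [Hm Hl].
      apply Rdiv_neg_neg; auto; simpl.
      apply Ropp_lt_gt_0_contravar, Rdiv_lt_0_compat; nra.
Qed.
End Solutions.


Theorem theorem1 (xm : R) (Hxm : 0 < xm) :
  exists (Tc : R -> R -> R) (Dl : R -> R -> R -> R) (D0 : R -> R -> R),
  (* domains: coordinates (mu, T, lam) resp. (mu, lam) *)
  let U3 := fun x : nat -> R =>
    0 < x 0%nat <= xm /\ 0 < x 2%nat /\ 0 < x 1%nat < Tc (x 0%nat) (x 2%nat) in
  let U2 := fun x : nat -> R => 0 < x 0%nat <= xm /\ 0 < x 1%nat in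
  let fD := fun x : nat -> R => Dl (x 0%nat) (x 1%nat) (x 2%nat) in
  let fTc := fun x : nat -> R => Tc (x 0%nat) (x 1%nat) in
  let fD0 := fun x : nat -> R => D0 (x 0%nat) (x 1%nat) in
  (* (i) *)
  (forall mu lam, 0 < mu <= xm -> 0 < lam ->
     0 < Tc mu lam /\
     (forall T, 0 < T < Tc mu lam ->
        0 < Dl mu T lam /\ gapR xm mu T lam (Dl mu T lam) /\
        (forall D, 0 < D -> gapR xm mu T lam D -> D = Dl mu T lam)) /\
     (forall T, Tc mu lam <= T ->
        Dl mu T lam = 0 /\
        (forall D, 0 <= D -> gapR xm mu T lam D -> D = 0))) /\
  Smooth 3 U3 fD /\ Smooth 2 U2 fTc /\
  (* (ii) *)
  pos_pderiv U3 fD 0 /\ neg_pderiv U3 fD 1 /\ pos_pderiv U3 fD 2 /\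
  (* (iii) *)
  (forall mu lam, 0 < mu <= xm -> 0 < lam ->
     forall eps, 0 < eps -> exists d, 0 < d /\
       forall T, Tc mu lam - d < T < Tc mu lam -> Rabs (Dl mu T lam) < eps) /\
  (* (iv) *)
  (forall mu lam, 0 < mu <= xm -> 0 < lam ->
     TcEq xm mu lam (Tc mu lam) /\
     (forall T, 0 < T -> TcEq xm mu lam T -> T = Tc mu lam)) /\
  (* (v) *)
  pos_pderiv U2 fTc 0 /\ pos_pderiv U2 fTc 1 /\
  (* (vi) *)
  (forall mu lam, 0 < mu <= xm -> 0 < lam ->
     0 < D0 mu lam /\ gap0 xm mu lam (D0 mu lam) /\
     (forall D, 0 < D -> gap0 xm mu lam D -> D = D0 mu lam) /\
     (forall eps, 0 < eps -> exists d, 0 < d /\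
        forall T, 0 < T < d -> Rabs (Dl mu T lam - D0 mu lam) < eps) /\
     (forall T, 0 < T -> D0 mu lam > Dl mu T lam /\ Dl mu T lam >= 0)) /\
  Smooth 2 U2 fD0 /\ pos_pderiv U2 fD0 0 /\ pos_pderiv U2 fD0 1 /\
  (forall mu lam, 0 < mu < xm -> 0 < lam ->
     xm / 2 * (lam - / lam) < D0 mu lam < xm / sinh (/ lam)) /\
  (forall lam, 0 < lam -> D0 xm lam = xm / sinh (/ lam)) /\
  (forall lam D, 0 < lam -> 0 < D ->
     (gap0 xm 0 lam D <-> (1 < lam /\ D = xm / 2 * (lam - / lam)))) /\
  (* (vii) *)
  (forall T lam D, 0 < T -> 0 < lam -> 0 < D -> gapR xm 0 T lam D -> 1 < lam).
Proof.
  exists (Tc xm), (Dl xm), (D0 xm); intros U3' U2' fD fTc fD0.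
  destruct (Dl_smooth xm) as [SD [PD0 [ND1 PD2]]]; [exact Hxm|].
  destruct (Tc_smooth xm) as [ST [PT0 PT1]]; [exact Hxm|].
  destruct (D0_smooth xm) as [SZ [PZ0 PZ1]]; [exact Hxm|].
  split.
  { intros mu lam Hm Hl; destruct (Tc_spec xm Hxm mu lam Hm Hl) as [P E].
    split; [exact P|split].
    - intros T HT; destruct (Dl_spec xm Hxm mu T lam Hm Hl HT) as [Q F].
      split; [exact Q|split].
      + apply gapR_iff; auto; lra.
      + intros D HD K; apply gapR_iff in K; try lra.
        apply (gapH_inj xm) with mu T; auto; lra.
    - intros T HT; split.
      + unfold Dl; destruct (Rlt_dec T (Tc xm mu lam)); lra.
      + intros D [HD|HD] K; [|auto].
        apply gapR_iff in K; try lra.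
        generalize (no_gap_above_Tc xm Hxm mu T lam D Hm Hl HT HD); lra. }
  split; [exact SD|]. split; [exact ST|].
  split; [exact PD0|]. split; [exact ND1|]. split; [exact PD2|].
  split; [intros; now apply Dl_to_0|].
  split.
  { intros mu lam Hm Hl; destruct (Tc_spec xm Hxm mu lam Hm Hl) as [P E]; split.
    - apply TcEq_iff; auto; lra.
    - intros T HT K; apply TcEq_iff in K; try lra.
      apply (gapG_inj xm) with mu; auto; lra. }
  split; [exact PT0|]. split; [exact PT1|].
  split.
  { intros mu lam Hm Hl; destruct (D0_spec xm Hxm mu lam Hm Hl) as [P E].
    split; [exact P|]. split; [symmetry; exact E|]. split; [|split].
    - intros D HD K; apply (gapZ_inj xm) with mu; auto; now rewrite E.
    - intros; now apply Dl_to_D0.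
    - intros T HT; generalize (Dl_lt_D0 xm Hxm mu T lam Hm Hl HT); lra. }
  split; [exact SZ|]. split; [exact PZ0|]. split; [exact PZ1|].
  split; [intros; now apply D0_bounds|].
  split.
  { intros lam Hl; destruct (D0_spec xm Hxm xm lam ltac:(lra) Hl) as [P E].
    apply (gapZ_inj xm) with xm; auto; [lra| |now rewrite gapZ_at_xm].
    apply Rdiv_lt_0_compat; auto; now apply sinh_pos, Rinv_0_lt_compat. }
  split; [intros; now apply gap0_at_0|].
  intros T lam D HT Hl HD; now apply gapR_at_0.
Qed.
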